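(* For all $f\in C_0^\infty(\mathbb{H}^N)$, $$\int_{\mathbb{H}^N}|\nabla_{\mathbb{H}}f|^2dV_{\mathbb{H}}-\left(\frac{N-2}{2}\right)^2\int_{\mathbb{H}^N}\frac{|f|^2}{\rho^2(x)}dV_{\mathbb{H}}=\int_{\mathbb{H}^N}\frac{1}{\rho^{N-2}(x)}\left|\nabla_{\mathbb{H}}\left(\rho^{\frac{N-2}{2}}(x)f\right)\right|^2dV_{\mathbb{H}}+\frac{(N-2)(N-1)}{2}\int_{\mathbb{H}^N}\frac{\rho(x)\cosh\rho(x)-\sinh\rho(x)}{\rho^2(x)\sinh\rho(x)}|f|^2dV_{\mathbb{H}}$$ and $$\int_{\mathbb{H}^N}|\partial_\rho f|^2dV_{\mathbb{H}}-\left(\frac{N-2}{2}\right)^2\int_{\mathbb{H}^N}\frac{|f|^2}{\rho^2(x)}dV_{\mathbb{H}}=\int_{\mathbb{H}^N}\frac{1}{\rho^{N-2}(x)}\left|\partial_\rho\left(\rho^{\frac{N-2}{2}}(x)f\right)\right|^2dV_{\mathbb{H}}+\frac{(N-2)(N-1)}{2}\int_{\mathbb{H}^N}\frac{\rho(x)\cosh\rho(x)-\sinh\rho(x)}{\rho^2(x)\sinh\rho(x)}|f|^2dV_{\mathbb{H}}.$$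
   Context: $\mathbb{H}^N$ is the $N$-dimensional hyperbolic space of constant sectional curvature $-1$, with gradient $\nabla_{\mathbb{H}}$ and volume element $dV_{\mathbb{H}}$; $\rho(x)$ is the geodesic distance from $x$ to a fixed point $O\in\mathbb{H}^N$ (the origin in the Poincaré ball model). $\partial_\rho f(x)=\frac{d}{dt}\big|_{t=\rho(x)}f(\exp_O(tu))$, where $x=\exp_O(\rho(x)u)$ with $u$ a unit tangent vector at $O$, is the radial derivative. $C_0^\infty(U)$ denotes smooth compactly supported functions on $U$. *)

(* Defs.v *)
From HB Require Import structures.
From mathcomp Require Import all_boot all_order all_algebra.
From mathcomp Require Import all_classical all_reals all_analysis.

Set Implicit Arguments.
Unset Strict Implicit.
Unset Printing Implicit Defensive.

Import Order.TTheory GRing.Theory Num.Theory.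
Import numFieldNormedType.Exports.

Local Open Scope classical_set_scope.
Local Open Scope ring_scope.

(* Lebesgue measure on R^n.  The library has measurable tuples and binary
   product measures only, so the measure is built by recursion on n, transporting
   the product along [cons_pair]. *)
Section lebesgue_tuple.
Context {R : realType}.

Notation mR := (measurableTypeR R).

Definition cons_pair n (p : mR * n.-tuple mR) : n.+1.-tuple mR :=
  [the n.+1.-tuple mR of p.1 :: p.2].

Lemma measurable_cons_pair n : measurable_fun setT (@cons_pair n).
Proof. by apply: measurable_cons. Qed.

Definition uncons_pair n (t : n.+1.-tuple mR) : mR * n.-tuple mR :=
  (thead t, [tuple of behead t]).

Lemma measurable_uncons_pair n : measurable_fun setT (@uncons_pair n).
Proof.
apply/measurable_fun_pairP; split; first exact: measurable_tnth.
exact: measurable_behead.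
Qed.

Lemma cons_pairK n : cancel (@cons_pair n) (@uncons_pair n).
Proof. by move=> [x t]; congr pair; apply/val_inj. Qed.

Section step.
Variables (n : nat) (mu : {sigma_finite_measure set (n.-tuple mR) -> \bar R}).

Definition lebesgue_step : set (n.+1.-tuple mR) -> \bar R :=
  pushforward (lebesgue_measure \x mu)%E (@cons_pair n).

Let preim_measurable (A : set (n.+1.-tuple mR)) :
  measurable A -> measurable (@cons_pair n @^-1` A).
Proof.
by move=> mA; rewrite -[X in measurable X]setTI; exact: measurable_cons_pair.
Qed.

Let step0 : lebesgue_step set0 = 0%E.
Proof. by rewrite /lebesgue_step /pushforward preimage_set0 measure0. Qed.

Let step_ge0 A : (0 <= lebesgue_step A)%E.
Proof. exact: (@measure_ge0 _ _ _ (lebesgue_measure \x mu)%E). Qed.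

Let step_sigma_additive : semi_sigma_additive lebesgue_step.
Proof.
move=> F mF tF mUF; rewrite /lebesgue_step /pushforward preimage_bigcup.
apply: measure_semi_sigma_additive.
- by move=> k; exact: preim_measurable.
- apply/trivIsetP => /= i j _ _ ij; rewrite -preimage_setI.
  by move/trivIsetP : tF => /(_ _ _ _ _ ij) ->//; rewrite preimage_set0.
- by rewrite -preimage_bigcup; exact: preim_measurable.
Qed.

HB.instance Definition _ := isMeasure.Build _ _ _ lebesgue_step
  step0 step_ge0 step_sigma_additive.

Let step_sigma_finite : sigma_finite setT lebesgue_step.
Proof.
have /sigma_finiteP[F [FT ndF Foo]] := sigma_finiteT (@lebesgue_measure R).
have /sigma_finiteP[G [GT ndG Goo]] := sigma_finiteT mu.
exists (fun k => @uncons_pair n @^-1` (F k `*` G k)).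
  apply/seteqP; split=> // t _.
  have [i _ Fi] : (\bigcup_i F i) (uncons_pair t).1 by rewrite -FT.
  have [j _ Gj] : (\bigcup_i G i) (uncons_pair t).2 by rewrite -GT.
  exists (maxn i j) => //; split.
  - by move: Fi; exact/subsetPset/ndF/leq_maxl.
  - by move: Gj; exact/subsetPset/ndG/leq_maxr.
move=> k; have [mF Fk] := Foo k; have [mG Gk] := Goo k; split.
  rewrite -[X in measurable X]setTI.
  by apply: measurable_uncons_pair => //; exact: measurableX.
rewrite /lebesgue_step /pushforward -comp_preimage.
rewrite (_ : _ @^-1` _ = F k `*` G k); last first.
  apply/funext=> p; rewrite /preimage.
  by change ((F k `*` G k) (uncons_pair (cons_pair p)) = (F k `*` G k) p);
    rewrite cons_pairK.
by rewrite product_measure1E// lte_mul_pinfty// ge0_fin_numE.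
Qed.

HB.instance Definition _ := Measure_isSigmaFinite.Build _ _ _ lebesgue_step
  step_sigma_finite.

End step.

Fixpoint lebesgue_tuple n : {sigma_finite_measure set (n.-tuple mR) -> \bar R} :=
  match n with
  | 0 => \d_[tuple] : {sigma_finite_measure set (0.-tuple mR) -> \bar R}
  | n'.+1 => lebesgue_step (lebesgue_tuple n')
  end.

End lebesgue_tuple.

(* A Riemannian metric in global coordinates: [U] is the coordinate domain in
   R^N and [g x] the Gram matrix of the metric at [x].  Points and tangent vectors
   are row vectors, so the metric pairing of [u] and [v] is u (g x) v^T. *)
Section riemannian.
Context {R : realType} {N : nat}.
Implicit Types (U : set 'rV[R]_N) (g : 'rV[R]_N -> 'M[R]_N).
Implicit Types (f F : 'rV[R]_N -> R) (c : R -> 'rV[R]_N) (x p q u v : 'rV[R]_N).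

Definition partial (i : 'I_N) f x : R := 'D_(delta_mx 0 i) f x.

Definition smooth_on U f : Prop :=
  forall s : seq 'I_N, forall x, U x -> differentiable (foldr partial f s) x.

(* Only the values of [f] on [U] matter. *)
Definition test_function U f : Prop :=
  smooth_on U f /\
  exists K : set 'rV[R]_N,
    [/\ compact K, K `<=` U & forall x, U x -> ~ K x -> f x = 0].

Definition metric_dot g x u v : R := (u *m g x *m v^T) 0 0.

Definition metric_norm g x u : R := Num.sqrt (metric_dot g x u u).

(* The vector w with g(w, v) = df(v) for every v. *)
Definition gradient g f x : 'rV[R]_N :=
  (\row_i partial i f x) *m invmx (g x).

Definition metric_integral U g F : \bar R :=
  let pt (t : N.-tuple (measurableTypeR R)) : 'rV[R]_N := \row_i tnth t i in
  (\int[lebesgue_tuple N]_(t in pt @^-1` U)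
     (F (pt t) * Num.sqrt (\det (g (pt t))))%:E)%E.

Definition curve_length g c : R :=
  \int[lebesgue_measure]_(t in `[0, 1]) metric_norm g (c t) (derive1 c t).

(* The velocity may vanish, so corners can be reparametrized away and C^1 curves
   give the same infimum as piecewise C^1 ones. *)
Definition joining_curve U p q c : Prop :=
  [/\ (forall t, derivable c t 1), continuous (derive1 c),
      (forall t, t \in `[0, 1] -> U (c t)), c 0 = p & c 1 = q].

Definition geodesic_dist U g p q : R :=
  inf [set curve_length g c | c in joining_curve U p q].

Definition christoffel g x (k i j : 'I_N) : R :=
  2^-1 * \sum_l invmx (g x) k l *
    (partial i (fun y => g y j l) x + partial j (fun y => g y i l) x
     - partial l (fun y => g y i j) x).

Definition geodesic U g c : Prop :=
  forall t, [/\ U (c t), derivable c t 1, derivable (derive1 c) t 1 &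
    forall k, (derive1 (derive1 c) t) 0 k +
      \sum_i \sum_j christoffel g (c t) k i j * (derive1 c t) 0 i * (derive1 c t) 0 j = 0].

Definition exp_map U g p v : 'rV[R]_N :=
  xget p [set q | exists c,
    [/\ geodesic U g c, c 0 = p, derive1 c 0 = v & c 1 = q]].

(* At x = p the direction is not unique and an arbitrary one is chosen. *)
Definition radial_direction U g p x : 'rV[R]_N :=
  xget 0 [set u | metric_norm g p u = 1 /\
    exp_map U g p (geodesic_dist U g p x *: u) = x].

Definition radial_derivative U g p f x : R :=
  derive1 (fun t : R => f (exp_map U g p (t *: radial_direction U g p x)))
    (geodesic_dist U g p x).

End riemannian.

Section hyperbolic.
Context {R : realType} {N : nat}.
Implicit Types (f F : 'rV[R]_N -> R) (x : 'rV[R]_N).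

Definition sqnorm x : R := \sum_i x 0 i ^+ 2.

Definition poincare_ball : set 'rV[R]_N := [set x | sqnorm x < 1].

Definition poincare_metric x : 'M[R]_N := ((2 / (1 - sqnorm x)) ^+ 2)%:M.

Definition hyp_test_function f : Prop := test_function poincare_ball f.

Definition hyp_rho x : R := geodesic_dist poincare_ball poincare_metric 0 x.

Definition hyp_grad_norm f x : R :=
  metric_norm poincare_metric x (gradient poincare_metric f x).

Definition hyp_radial f x : R :=
  radial_derivative poincare_ball poincare_metric 0 f x.

Definition hyp_integral F : \bar R :=
  metric_integral poincare_ball poincare_metric F.

End hyperbolic.

Definition sinh {R : realType} (r : R) : R := (expR r - expR (- r)) / 2.

Definition cosh {R : realType} (r : R) : R := (expR r + expR (- r)) / 2.

(* Main.v *)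
From HB Require Import structures.
Require Import Defs.
From mathcomp Require Import all_boot all_order all_algebra.
From mathcomp Require Import all_classical all_reals all_analysis.
From mathcomp Require Import measurable_realfun.
From mathcomp Require Import ring lra.

Set Implicit Arguments.
Unset Strict Implicit.
Unset Printing Implicit Defensive.

Import Order.TTheory GRing.Theory Num.Theory.
Import numFieldNormedType.Exports.

Local Open Scope classical_set_scope.
Local Open Scope ring_scope.

(** The two identities are pointwise algebra plus one integration by parts.
    Put a = (N - 2) / 2 and let rho be the distance to the centre.  Since rho
    has unit gradient, expanding the gradient of rho^a f gives

      rho^(-2a) |grad (rho^a f)|^2
        = |grad f|^2 + 2a f f_rho / rho + a^2 f^2 / rho^2,

    and the same with the radial derivative f_rho in place of grad f.  Hence
    both identities say that the integral of a (f^2)_rho / rho + 2 a^2 f^2 / rho^2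
    is that of - a (N - 1) f^2 (coth rho / rho - 1 / rho^2).  As the Laplacian of
    rho is (N - 1) coth rho, this holds because the divergence of
    f^2 (grad rho) / rho has integral zero.

    Everything is expressed in the ball with r = |x| and the conformal factor
    c = 2 / (1 - r^2).  There rho = ln ((1 + r) / (1 - r)) ([hyp_rhoE]): the
    segment from 0 to x realizes this length, and the function t |-> rho of the
    component of a curve along x / r grows no faster than its arc length.  The
    geodesic equation from the centre is solved through the hyperboloid
    coordinates c - 1 and c x_i, which satisfy the linear equation y'' = k^2 y
    along any geodesic of speed k ([geodesic_end]); this identifies the
    exponential map, hence the radial derivative ([hyp_radialE]).

    The field f^2 (grad rho) / rho is, in coordinates and with the density c^N,
    the radial field W(x) x with W = f^2 c^(N-1) / (r rho) ([flux]).  Its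
    divergence D satisfies d/ds (e^(N s) W (e^s x)) = e^(N s) D (e^s x), so
    integrating over x and over 0 <= s <= 1, and using that Lebesgue measure
    scales by e^(N s), gives the vanishing of the integral of D
    ([integral_dilation_derivative], [integral_flux_div]).  Differentiating
    only along rays avoids any treatment of the singularity at the
    centre, except that W and D, of size 1 / r^2, must be integrable; for N >= 3
    this again follows from scaling ([integrable_inv_sqnorm]).  When N = 2 the
    constant a vanishes and the identities are trivial. *)

(** * Calculus along curves of row vectors *)

Section continuity_at_a_point.
Context {R : realType} {T : topologicalType}.
Implicit Types (f g : T -> R) (x : T).

Lemma continuous_atM f g x : {for x, continuous f} -> {for x, continuous g} ->
  {for x, continuous (fun y => f y * g y)}.
Proof. by move=> cf cg; exact: cvgM. Qed.

Lemma continuous_atD f g x : {for x, continuous f} -> {for x, continuous g} ->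
  {for x, continuous (fun y => f y + g y)}.
Proof. by move=> cf cg; exact: cvgD. Qed.

Lemma continuous_atB f g x : {for x, continuous f} -> {for x, continuous g} ->
  {for x, continuous (fun y => f y - g y)}.
Proof. by move=> cf cg; exact: cvgB. Qed.

Lemma continuous_atV f x : f x != 0 -> {for x, continuous f} ->
  {for x, continuous (fun y => (f y)^-1)}.
Proof. by move=> fx cf; exact: cvgV. Qed.

Lemma continuous_atX f n x : {for x, continuous f} ->
  {for x, continuous (fun y => f y ^+ n)}.
Proof.
move=> cf; apply: (@continuous_comp _ _ _ f (fun r : R => r ^+ n)) => //.
exact: exprn_continuous.
Qed.

Lemma continuous_at_cst (a : R) x : {for x, continuous (fun=> a : R)}.
Proof. exact: cvg_cst. Qed.

Lemma continuous_at_sum n (h : 'I_n -> T -> R) x :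
  (forall i, {for x, continuous (h i)}) ->
  {for x, continuous (fun y => \sum_i h i y)}.
Proof. by move=> ch; apply: cvg_big => [|i _]; [exact: add_continuous|exact: ch]. Qed.

End continuity_at_a_point.

Section calculus.
Context {R : realType} {N : nat}.
Implicit Types (f : 'rV[R]_N -> R) (c : R -> 'rV[R]_N) (x v : 'rV[R]_N) (t : R).

Lemma is_derive_rV c t v :
  (forall i, is_derive t 1 (fun s => c s 0 i) (v 0 i)) -> is_derive t 1 c v.
Proof.
move=> H.
have dc : derivable c t 1.
  by apply/derivable_mxP => i j; rewrite ord1; exact: (@ex_derive _ _ _ _ _ _ _ (H j)).
split=> //; rewrite derive_mx//; apply/rowP => j.
by rewrite mxE; exact: derive_val.
Qed.

Lemma is_derive_coord c t v i :
  is_derive t 1 c v -> is_derive t 1 (fun s => c s 0 i) (v 0 i).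
Proof.
move=> [dc <-]; rewrite derive_mx// mxE; apply/derivableP.
by have /derivable_mxP := dc; exact.
Qed.

(** The chain rule in coordinates, which turns directional, radial and dilation
    derivatives into one-variable calculus. *)
Lemma is_derive_comp_curve f c t v :
  differentiable f (c t) -> is_derive t 1 c v ->
  is_derive t 1 (fun s => f (c s)) (\sum_i v 0 i * partial i f (c t)).
Proof.
move=> df [dc cv].
have dc' : differentiable c t by apply/derivable1_diffP.
have dfc : differentiable (f \o c) t by exact: differentiable_comp.
split; first exact/derivable1_diffP.
rewrite (@deriveE _ _ _ (f \o c))// diff_comp//= -(@deriveE _ _ _ c)// cv.
rewrite {1}(row_sum_delta v) linear_sum; apply: eq_bigr => i _.
by rewrite linearZ/= /partial deriveE.
Qed.

Lemma near_open_curve (c : R -> 'rV[R]_N) (O : set 'rV[R]_N) (s : R) :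
  {for s, continuous c} -> open O -> O (c s) -> \forall u \near s, O (c u).
Proof.
move=> cc oO Os; apply: cc; apply: open_nbhs_nbhs; split => //.
Qed.

Lemma is_derive_dilation x (s : R) : is_derive s 1 (fun u : R => expR u *: x) (expR s *: x).
Proof.
apply: is_derive_rV => i; under eq_fun do rewrite mxE.
by rewrite mxE; apply: is_derive_eq; rewrite /GRing.scale/=; ring.
Qed.

Lemma continuous_curve c t : derivable c t 1 -> {for t, continuous c}.
Proof. by move=> dc; apply/differentiable_continuous/derivable1_diffP. Qed.

Lemma sqnorm_ge0 x : 0 <= sqnorm x.
Proof. by apply: sumr_ge0 => i _; exact: sqr_ge0. Qed.

Lemma sqnorm_eq0 x : (sqnorm x == 0) = (x == 0).
Proof.
apply/idP/eqP => [|->]; last first.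
  by rewrite /sqnorm big1// => i _; rewrite mxE expr0n.
rewrite psumr_eq0 => [/allP h|i _]; last exact: sqr_ge0.
apply/rowP => i; rewrite mxE; apply/eqP; rewrite -sqrf_eq0.
by apply: (implyP (h i _)) => //; rewrite mem_index_enum.
Qed.

Lemma sqnorm_gt0 x : (0 < sqnorm x) = (x != 0).
Proof. by rewrite lt_def sqnorm_ge0 andbT sqnorm_eq0. Qed.

Lemma sqnormZ a x : sqnorm (a *: x) = a ^+ 2 * sqnorm x.
Proof.
by rewrite /sqnorm mulr_sumr; apply: eq_bigr => i _; rewrite mxE exprMn.
Qed.

Lemma differentiable_sqnorm x : differentiable (@sqnorm R N) x.
Proof.
rewrite (_ : @sqnorm R N = \sum_i (fun y : 'rV[R]_N => y 0 i ^+ 2)); last first.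
  by apply/funext => y; rewrite fct_sumE.
apply: differentiable_sum => i.
under eq_fun do rewrite expr2.
by apply: differentiableM; exact: differentiable_coord.
Qed.

Lemma continuous_sqnorm : continuous (@sqnorm R N).
Proof. by move=> x; exact/differentiable_continuous/differentiable_sqnorm. Qed.

Lemma is_derive_sqnorm c t v : is_derive t 1 c v ->
  is_derive t 1 (fun s => sqnorm (c s)) (2 * \sum_i c t 0 i * v 0 i).
Proof.
move=> dc; rewrite /sqnorm.
have := @is_derive_sum R R R N (fun i s => c s 0 i ^+ 2) t 1
  (fun i => 2 * (c t 0 i * v 0 i)).
rewrite -mulr_sumr (_ : \sum_i _ = (fun s => \sum_i c s 0 i ^+ 2)); last first.
  by apply/funext => s; rewrite fct_sumE.
apply=> i; have dci := is_derive_coord i dc.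
apply: is_derive_eq; rewrite /GRing.scale/=; ring.
Qed.

Lemma open_poincare_ball : open (@poincare_ball R N).
Proof.
rewrite /poincare_ball.
rewrite (_ : [set x | _] = (@sqnorm R N) @^-1` [set r | r < 1])//.
apply: open_comp; last exact: open_lt.
by move=> x _; exact: continuous_sqnorm.
Qed.

End calculus.

(** * The radial functions of one variable *)

Section one_variable.
Context {R : realType}.
Implicit Types (f g F : R -> R) (r t : R).

Lemma is_derive_ln_comp g b t :
  0 < g t -> is_derive t 1 g b -> is_derive t 1 (fun s => ln (g s)) (b / g t).
Proof.
move=> g0 dg; have dl := is_derive1_ln g0.
by have := @is_derive1_comp R (@ln R) g t _ _ dl dg; rewrite mulrC.
Qed.

Lemma is_derive_sqrt_comp g b t :
  0 < g t -> is_derive t 1 g b ->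
  is_derive t 1 (fun s => Num.sqrt (g s)) (b / (2 * Num.sqrt (g t))).
Proof.
move=> g0 dg; have dl := is_derive1_sqrt g0.
by have := @is_derive1_comp R (@Num.sqrt R) g t _ _ dl dg; rewrite mulrC.
Qed.

Lemma is_derive_div f g a b t : g t != 0 ->
  is_derive t 1 f a -> is_derive t 1 g b ->
  is_derive t 1 (fun s => f s / g s) ((a * g t - f t * b) / g t ^+ 2).
Proof.
move=> g0 df dg.
have dv := is_deriveV g0 dg.
apply: is_derive_eq; rewrite /GRing.scale/=.
by field.
Qed.

Lemma is_derive_mul (g h : R -> R) (a b t : R) :
  is_derive t 1 g a -> is_derive t 1 h b ->
  is_derive t 1 (fun s => g s * h s) (a * h t + g t * b).
Proof. by move=> dg dh; apply: is_derive_eq; rewrite /GRing.scale/=; ring. Qed.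

Lemma is_derive_pow (g : R -> R) n (a t : R) : g t != 0 -> is_derive t 1 g a ->
  is_derive t 1 (fun s => g s ^+ n) (n%:R * g t ^+ n / g t * a).
Proof.
move=> g0 dg; rewrite -[fun s => _]/(fun s => (g s) ^+ n) -exprfctE.
apply: (is_derive_eq (is_deriveX n dg)).
rewrite /GRing.scale/=; case: n => [|n]; first by rewrite !mul0r.
by rewrite /= [g t ^+ n.+1]exprS; field.
Qed.

Lemma near_eq_continuous (g h : R -> R) (s : R) :
  (\forall u \near s, g u = h u) -> {for s, continuous g} -> {for s, continuous h}.
Proof.
move=> gh; rewrite /prop_for /continuous_at -(nbhs_singleton gh) => cg.
exact: cvg_trans (near_eq_cvg gh) cg.
Qed.

Lemma FTC2_01 (f F : R -> R) :
  (forall t, 0 <= t <= 1 -> is_derive t 1 F (f t)) ->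
  (forall t, 0 <= t <= 1 -> {for t, continuous f}) ->
  (\int[lebesgue_measure]_(t in `[0%R, 1%R]) (f t)%:E = (F 1 - F 0)%:E)%E.
Proof.
move=> dF cf.
have cF t : 0 <= t <= 1 -> {for t, continuous F}.
  move=> /dF dFt.
  apply/differentiable_continuous/derivable1_diffP.
  exact: (@ex_derive _ _ _ _ _ _ _ dFt).
rewrite (@continuous_FTC2 R f F 0 1)//.
- by apply: continuous_in_subspaceT => t; rewrite inE/= in_itv/=; exact: cf.
- split.
  + move=> t; rewrite in_itv/= => /andP[/ltW t0 /ltW t1].
    apply: (@ex_derive _ _ _ _ _ _ _ (dF t _)); exact/andP.
  + by apply: cvg_at_right_filter; apply: cF; rewrite lexx ler01.
  + by apply: cvg_at_left_filter; apply: cF; rewrite lexx ler01.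
- move=> t; rewrite in_itv/= => /andP[/ltW t0 /ltW t1].
  rewrite derive1E; apply: (@derive_val _ _ _ _ _ _ _ (dF t _)); exact/andP.
Qed.

Lemma integrable_continuous01 (f : R -> R) :
  (forall t, 0 <= t <= 1 -> {for t, continuous f}) ->
  (@lebesgue_measure R).-integrable `[0, 1] (EFin \o f).
Proof.
move=> cf; apply: continuous_compact_integrable; first exact: segment_compact.
by apply: continuous_in_subspaceT => t; rewrite inE/= in_itv/=; exact: cf.
Qed.

(** Twice the inverse hyperbolic tangent: the distance to the centre as a function
    of the Euclidean norm. *)
Definition hyp_radius r : R := ln ((1 + r) / (1 - r)).

Lemma is_derive_hyp_radius r : -1 < r < 1 ->
  is_derive r 1 hyp_radius (2 / (1 - r ^+ 2)).
Proof.
move=> /andP[r1 r2].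
have h1 : is_derive r 1 (fun s : R => 1 + s) 1 by apply: is_derive_eq; ring.
have h2 : is_derive r 1 (fun s : R => 1 - s) (-1) by apply: is_derive_eq; ring.
have h0 : 1 - r != 0 by lra.
have h3 := @is_derive_div (fun s => 1 + s) (fun s => 1 - s) _ _ _ h0 h1 h2.
have g0 : 0 < (1 + r) / (1 - r) by apply: divr_gt0; lra.
have := @is_derive_ln_comp (fun s => (1 + s) / (1 - s)) _ _ g0 h3.
move/is_derive_eq; apply.
have : 1 + r != 0 by lra.
have : 1 - r ^+ 2 != 0 by nra.
move=> *; field.
by apply/and3P.
Qed.

Lemma hyp_radius0 : hyp_radius 0 = 0.
Proof. by rewrite /hyp_radius addr0 subr0 divr1 ln1. Qed.

Lemma expR_hyp_radius r : -1 < r < 1 -> expR (hyp_radius r) = (1 + r) / (1 - r).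
Proof.
by move=> /andP[r1 r2]; rewrite /hyp_radius lnK// posrE divr_gt0//; lra.
Qed.

Lemma sinh_hyp_radius r : -1 < r < 1 -> sinh (hyp_radius r) = 2 * r / (1 - r ^+ 2).
Proof.
move=> r1; rewrite /sinh expRN expR_hyp_radius//.
field; move/andP: r1 => [r1 r2]; apply/and3P; split; nra.
Qed.

Lemma cosh_hyp_radius r : -1 < r < 1 ->
  cosh (hyp_radius r) = (1 + r ^+ 2) / (1 - r ^+ 2).
Proof.
move=> r1; rewrite /cosh expRN expR_hyp_radius//.
field; move/andP: r1 => [r1 r2]; apply/and3P; split; nra.
Qed.

(** The hyperbolic tangent of t / 2, inverse to [hyp_radius]. *)
Definition tanh_half t : R := (expR t - 1) / (expR t + 1).

Lemma tanh_half_hyp_radius r : -1 < r < 1 -> tanh_half (hyp_radius r) = r.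
Proof.
move=> r1; rewrite /tanh_half expR_hyp_radius//.
field; move/andP: r1 => [r1 r2]; apply/andP; split; lra.
Qed.

Lemma tanh_half_itv t : -1 < tanh_half t < 1.
Proof.
have e0 := expR_gt0 t.
by rewrite /tanh_half ltr_pdivlMr ?ltr_pdivrMr; [apply/andP; split|..]; lra.
Qed.

Lemma is_derive_tanh_half t : is_derive t 1 tanh_half ((1 - tanh_half t ^+ 2) / 2).
Proof.
have e0 := expR_gt0 t.
have h1 : is_derive t 1 (fun s : R => expR s - 1) (expR t).
  by apply: is_derive_eq; ring.
have h2 : is_derive t 1 (fun s : R => expR s + 1) (expR t).
  by apply: is_derive_eq; ring.
have h0 : expR t + 1 != 0 by lra.
have := @is_derive_div (fun s => expR s - 1) (fun s => expR s + 1) _ _ _ h0 h1 h2.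
move/is_derive_eq; apply; rewrite /tanh_half; field.
exact: h0.
Qed.

Lemma continuous_hyp_radius r : -1 < r < 1 -> {for r, continuous hyp_radius}.
Proof.
move=> r1; apply/differentiable_continuous/derivable1_diffP.
exact: (@ex_derive _ _ _ _ _ _ _ (is_derive_hyp_radius r1)).
Qed.

(** The derivative of [hyp_radius] is at least 2. This controls the kernels
    1 / rho by 1 / r without any upper bound on rho. *)
Lemma hyp_radius_ge r : 0 <= r < 1 -> 2 * r <= hyp_radius r.
Proof.
move=> /andP[r0 r1].
have [||c] := @MVT_segment R hyp_radius (fun s => 2 / (1 - s ^+ 2)) 0 r r0.
- move=> x; rewrite in_itv/= => /andP[x0 xr].
  by apply: is_derive_hyp_radius; apply/andP; split; lra.
- apply: continuous_in_subspaceT => x; rewrite inE/= in_itv/= => /andP[x0 xr].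
  by apply: continuous_hyp_radius; apply/andP; split; lra.
rewrite in_itv/= => /andP[c0 cr]; rewrite hyp_radius0 !subr0 => ->.
by rewrite ler_wpM2r// ler_pdivlMr; nra.
Qed.

End one_variable.

(** * The metric of the ball and the distance to its centre *)

Section conformal_metric.
Context {R : realType} {N : nat}.
Implicit Types (f : 'rV[R]_N -> R) (c : R -> 'rV[R]_N) (x u v : 'rV[R]_N).

Definition euclid_norm x : R := Num.sqrt (sqnorm x).

Definition conformal_factor x : R := 2 / (1 - sqnorm x).

Lemma euclid_norm_ge0 x : 0 <= euclid_norm x.
Proof. exact: sqrtr_ge0. Qed.

Lemma sqr_euclid_norm x : euclid_norm x ^+ 2 = sqnorm x.
Proof. by rewrite sqr_sqrtr// sqnorm_ge0. Qed.

Lemma euclid_norm_gt0 x : x != 0 -> 0 < euclid_norm x.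
Proof. by move=> x0; rewrite sqrtr_gt0 lt_neqAle sqnorm_ge0 eq_sym sqnorm_eq0 x0. Qed.

Lemma euclid_normZ a x : euclid_norm (a *: x) = `|a| * euclid_norm x.
Proof. by rewrite /euclid_norm sqnormZ sqrtrM ?sqr_ge0// sqrtr_sqr. Qed.

Lemma poincare_ballE x : poincare_ball x <-> euclid_norm x < 1.
Proof.
rewrite /poincare_ball/= -sqr_euclid_norm.
by rewrite expr_lt1// euclid_norm_ge0.
Qed.

Lemma euclid_norm_itv x : poincare_ball x -> -1 < euclid_norm x < 1.
Proof.
by move=> /poincare_ballE ->; rewrite andbT (lt_le_trans _ (euclid_norm_ge0 x)).
Qed.

Lemma conformal_factor_gt0 x : poincare_ball x -> 0 < conformal_factor x.
Proof. by rewrite /poincare_ball/= => x1; rewrite divr_gt0// subr_gt0. Qed.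

Lemma metric_dot_poincare x u v :
  metric_dot poincare_metric x u v = conformal_factor x ^+ 2 * \sum_i u 0 i * v 0 i.
Proof.
rewrite /metric_dot /poincare_metric mul_mx_scalar -scalemxAl mxE; congr *%R.
by rewrite mxE; apply: eq_bigr => i _; rewrite mxE.
Qed.

Lemma metric_norm_poincare x u : poincare_ball x ->
  metric_norm poincare_metric x u = conformal_factor x * euclid_norm u.
Proof.
move=> Ux; rewrite /metric_norm metric_dot_poincare sqrtrM ?sqr_ge0// sqrtr_sqr.
rewrite ger0_norm; last exact/ltW/conformal_factor_gt0.
by congr (_ * Num.sqrt _); apply: eq_bigr => i _; rewrite expr2.
Qed.

Lemma poincare_density x : poincare_ball x ->
  Num.sqrt (\det (poincare_metric x)) = conformal_factor x ^+ N.
Proof.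
move=> Ux; rewrite /poincare_metric det_scalar -exprM mulnC exprM sqrtr_sqr.
by rewrite ger0_norm// exprn_ge0// ltW// conformal_factor_gt0.
Qed.

Lemma invmx_poincare x : poincare_ball x ->
  invmx (poincare_metric x) = (conformal_factor x ^- 2)%:M.
Proof.
by move=> Ux; rewrite /poincare_metric -/(conformal_factor x) invmx_scalar.
Qed.

Lemma sqr_hyp_grad_norm f x : poincare_ball x ->
  hyp_grad_norm f x ^+ 2 =
  (\sum_i partial i f x ^+ 2) / conformal_factor x ^+ 2.
Proof.
move=> Ux; have c0 := conformal_factor_gt0 Ux.
rewrite /hyp_grad_norm metric_norm_poincare// exprMn sqr_euclid_norm /gradient.
rewrite invmx_poincare// mul_mx_scalar sqnormZ.
rewrite (_ : sqnorm _ = \sum_i partial i f x ^+ 2); last first.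
  by apply: eq_bigr => i _; rewrite mxE.
by field; rewrite gt_eqF.
Qed.

End conformal_metric.

Section distance_to_centre.
Context {R : realType} {N : nat}.
Implicit Types (c : R -> 'rV[R]_N) (x u v : 'rV[R]_N) (t : R).

(** Cauchy-Schwarz against a unit vector, from the square of the component of v
    orthogonal to u. *)
Lemma dot_unit_le u v : sqnorm u = 1 ->
  (\sum_i v 0 i * u 0 i) ^+ 2 <= sqnorm v.
Proof.
move=> u1; set a := \sum_i _.
have : 0 <= sqnorm (v - a *: u) by exact: sqnorm_ge0.
rewrite /sqnorm.
under eq_bigr => i _.
  rewrite (_ : _ ^+ 2 = v 0 i ^+ 2 + ((- (2 * a)) * (v 0 i * u 0 i)
    + a ^+ 2 * u 0 i ^+ 2)); last by rewrite !mxE; ring.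
  over.
rewrite !big_split/= -!mulr_sumr -/a -/(sqnorm u) u1 -/(sqnorm v).
by move=> ?; nra.
Qed.

Lemma continuous_conformal_factor x : poincare_ball x ->
  {for x, continuous (@conformal_factor R N)}.
Proof.
move=> Ux; change {for x, continuous (fun y : 'rV[R]_N => 2 * (1 - sqnorm y)^-1)}.
apply: continuous_atM; first exact: continuous_at_cst.
apply: continuous_atV; first by rewrite gt_eqF// subr_gt0.
by apply: continuous_atB; [exact: continuous_at_cst|exact: continuous_sqnorm].
Qed.

Lemma continuous_speed c t : derivable c t 1 -> {for t, continuous (derive1 c)} ->
  poincare_ball (c t) ->
  {for t, continuous (fun s => conformal_factor (c s) * euclid_norm (derive1 c s))}.
Proof.
move=> dc cc Uc.
apply: continuous_atM.
  apply: (@continuous_comp _ _ _ c (@conformal_factor R N)).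
    exact: continuous_curve.
  exact: continuous_conformal_factor.
apply: (@continuous_comp _ _ _ _ Num.sqrt); last exact: sqrt_continuous.
by apply: continuous_comp => //; exact: continuous_sqnorm.
Qed.

Lemma curve_length_poincare c (cU : forall t, t \in `[0, 1] -> poincare_ball (c t)) :
  curve_length poincare_metric c =
  \int[lebesgue_measure]_(t in `[0, 1])
    (conformal_factor (c t) * euclid_norm (derive1 c t)).
Proof.
by apply: eq_Rintegral => t; rewrite inE => t01; rewrite metric_norm_poincare//; exact: cU.
Qed.

(** Projecting the curve on the direction u of x avoids differentiating the norm,
    which is singular at the centre: the component p of the curve along u has
    p^2 <= |c|^2 and |p'| <= |c'|, so the speed of c dominates the derivative of
    [hyp_radius] along p. *)
Lemma curve_length_ge c x : x != 0 -> joining_curve poincare_ball 0 x c ->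
  hyp_radius (euclid_norm x) <= curve_length poincare_metric c.
Proof.
move=> x0 [dc cc cU c0 c1].
have r0 := euclid_norm_gt0 x0.
set r := euclid_norm x.
pose u := r^-1 *: x.
have u1 : sqnorm u = 1.
  by rewrite sqnormZ -sqr_euclid_norm -/r -exprMn mulVf ?expr1n// gt_eqF.
pose p t := \sum_i c t 0 i * u 0 i.
pose q t := \sum_i derive1 c t 0 i * u 0 i.
have dp (t : R) : is_derive t 1 p (q t).
  rewrite /p /q.
  have := @is_derive_sum R R R N (fun i s => c s 0 i * u 0 i) t 1
    (fun i => derive1 c t 0 i * u 0 i).
  rewrite (_ : \sum_i _ = (fun s => \sum_i c s 0 i * u 0 i)); last first.
    by apply/funext => s; rewrite fct_sumE.
  apply=> i; have dct : is_derive t 1 c (derive1 c t).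
    by rewrite derive1E; apply/derivableP; exact: dc.
  have dci := is_derive_coord i dct.
  by apply: is_derive_eq; rewrite /GRing.scale/=; ring.
have pc (t : R) : p t ^+ 2 <= sqnorm (c t) by exact: dot_unit_le.
have U01 (t : R) : 0 <= t <= 1 -> poincare_ball (c t).
  by move=> t01; apply: cU; rewrite in_itv.
have p1 (t : R) : 0 <= t <= 1 -> -1 < p t < 1.
  move=> /U01; rewrite /poincare_ball/= => ct1; have := pc t => pt.
  by apply/andP; split; nra.
pose g t := 2 / (1 - p t ^+ 2) * q t.
have dg (t : R) : 0 <= t <= 1 -> is_derive t 1 (hyp_radius \o p) (g t).
  by move=> t01; apply: is_derive1_comp; exact: is_derive_hyp_radius (p1 _ t01).
have cp (t : R) : {for t, continuous p}.
  apply/differentiable_continuous/derivable1_diffP.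
  exact: (@ex_derive _ _ _ _ _ _ _ (dp t)).
have cq (t : R) : {for t, continuous q}.
  rewrite /q.
  apply: (@continuous_comp _ _ _ (derive1 c) (fun y : 'rV[R]_N => \sum_i y 0 i * u 0 i)).
    exact: cc.
  move=> y; apply: continuous_at_sum => i.
  apply: continuous_atM; last exact: continuous_at_cst.
  exact: coord_continuous.
have cg (t : R) : 0 <= t <= 1 -> {for t, continuous g}.
  move=> t01; change {for t, continuous (fun s => 2 * (1 - p s ^+ 2)^-1 * q s)}.
  apply: continuous_atM; last exact: cq.
  apply: continuous_atM; first exact: continuous_at_cst.
  apply: continuous_atV; first by have /andP[] := p1 _ t01 => ? ?; rewrite gt_eqF//; nra.
  apply: continuous_atB; first exact: continuous_at_cst.
  by apply: continuous_atX; exact: cp.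
have cs (t : R) : 0 <= t <= 1 -> {for t, continuous
    (fun s => conformal_factor (c s) * euclid_norm (derive1 c s))}.
  by move=> t01; apply: continuous_speed; [exact: dc|exact: cc|exact: U01].
have := FTC2_01 dg cg.
have p_0 : p 0 = 0.
  by rewrite /p c0 big1// => i _; rewrite mxE mul0r.
have p_1 : p 1 = r.
  rewrite /p c1 /u; under eq_bigr do rewrite mxE mulrCA -expr2.
  by rewrite -mulr_sumr -/(sqnorm x) -sqr_euclid_norm -/r; field; rewrite gt_eqF.
rewrite /= p_0 p_1 hyp_radius0 subr0 => Lr.
rewrite curve_length_poincare// -[leLHS]/(fine (hyp_radius r)%:E) -Lr.
apply: le_Rintegral => //.
- exact: integrable_continuous01.
- exact: integrable_continuous01.
move=> t /=; rewrite in_itv/= => t01.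
have := U01 _ t01; rewrite /poincare_ball/= /conformal_factor => ct1.
have /andP[pt1 pt2] := p1 _ t01.
have qn : q t <= euclid_norm (derive1 c t).
  rewrite (le_trans (ler_norm _))// -sqrtr_sqr ler_wsqrtr//.
  exact: dot_unit_le.
rewrite /g; apply: (@le_trans _ _ (2 / (1 - p t ^+ 2) * euclid_norm (derive1 c t))).
  by rewrite ler_wpM2l// divr_ge0//; nra.
rewrite ler_wpM2r ?euclid_norm_ge0// ler_wpM2l//.
rewrite lef_pV2 ?posrE ?subr_gt0//; last by nra.
by rewrite lerD2l lerN2.
Qed.

Lemma is_derive_segment x t : is_derive t 1 (fun s : R => s *: x) x.
Proof.
apply: is_derive_rV => i; under eq_fun do rewrite mxE.
by apply: is_derive_eq; rewrite /GRing.scale/=; ring.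
Qed.

Lemma derive1_segment x : derive1 (fun s : R => s *: x) = cst x.
Proof.
apply/funext => t; rewrite derive1E.
exact: (@derive_val _ _ _ _ _ _ _ (is_derive_segment x t)).
Qed.

Lemma joining_segment x : poincare_ball x ->
  joining_curve poincare_ball 0 x (fun s : R => s *: x).
Proof.
move=> Ux; split.
- by move=> t; exact: (@ex_derive _ _ _ _ _ _ _ (is_derive_segment x t)).
- by rewrite derive1_segment; move=> t; exact: cst_continuous.
- move=> t; rewrite in_itv/= => /andP[t0 t1].
  move: Ux; rewrite /poincare_ball/= sqnormZ => Ux; have := sqnorm_ge0 x => x0.
  have : t ^+ 2 <= 1 by nra.
  by move=> ?; nra.
- by rewrite scale0r.
- by rewrite scale1r.
Qed.

Lemma curve_length_segment x : poincare_ball x ->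
  curve_length poincare_metric (fun s : R => s *: x) = hyp_radius (euclid_norm x).
Proof.
move=> Ux; have [dc cc cU _ _] := joining_segment Ux.
have /andP[_ r1] := euclid_norm_itv Ux; have r0 := euclid_norm_ge0 x.
rewrite curve_length_poincare// derive1_segment.
set r := euclid_norm x in r0 r1 *.
have tr (t : R) : 0 <= t <= 1 -> -1 < t * r < 1 by move=> /andP[t0 t1]; apply/andP; split; nra.
have dF (t : R) : 0 <= t <= 1 -> is_derive t 1 (hyp_radius \o (fun s => s * r))
    (conformal_factor (t *: x) * euclid_norm (cst x t)).
  move=> t01; have h1 := is_derive_hyp_radius (tr _ t01).
  have h2 : is_derive t 1 (fun s : R => s * r) r.
    by apply: is_derive_eq; rewrite /GRing.scale/=; ring.
  have := @is_derive1_comp R hyp_radius (fun s => s * r) t _ _ h1 h2.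
  by rewrite /conformal_factor sqnormZ -sqr_euclid_norm -/r exprMn.
have cf (t : R) : 0 <= t <= 1 -> {for t, continuous
    (fun s : R => conformal_factor (s *: x) * euclid_norm (cst x s))}.
  move=> t01; have := @continuous_speed (fun s : R => s *: x) t.
  rewrite derive1_segment; apply => //.
  - by move=> ?; exact: cst_continuous.
  - by apply: cU; rewrite in_itv.
by rewrite /Rintegral (FTC2_01 dF cf)/= mul0r mul1r hyp_radius0 subr0.
Qed.

(** The infimum of the lengths is attained by the segment. *)
Lemma hyp_rhoE x : poincare_ball x -> x != 0 ->
  hyp_rho x = hyp_radius (euclid_norm x).
Proof.
move=> Ux x0; rewrite /hyp_rho /geodesic_dist.
set S := [set _ | _ in _].
have Sx : S (hyp_radius (euclid_norm x)).
  exists (fun s : R => s *: x); first exact: joining_segment.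
  exact: curve_length_segment.
have lbS : lbound S (hyp_radius (euclid_norm x)).
  by move=> _ [c jc <-]; exact: curve_length_ge.
apply/eqP; rewrite eq_le; apply/andP; split.
  by apply: ge_inf => //; exists (hyp_radius (euclid_norm x)).
by apply: lb_le_inf => //; exists (hyp_radius (euclid_norm x)).
Qed.

End distance_to_centre.

(** * Geodesics, the exponential map and the radial derivative *)

Section partial_derivatives.
Context {R : realType} {N : nat}.
Implicit Types (F : 'rV[R]_N -> R) (c : R -> 'rV[R]_N) (x v : 'rV[R]_N) (t : R).

Lemma is_derive_line F x v d :
  is_derive (0 : R) 1 (fun t : R => F (t *: v + x)) d -> is_derive x v F d.
Proof.
move=> [H1 H2].
have E : (fun h : R => h^-1 *: (F (h *: v + x) - F x)) =
    (fun h : R => h^-1 *: (F ((h *: 1 + 0) *: v + x) - F (0 *: v + x))).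
  apply/funext => h; rewrite scale0r add0r addr0.
  by rewrite /GRing.scale/= mulr1.
by split; rewrite /derivable /derive E.
Qed.

Lemma is_derive_line_id x v : is_derive (0 : R) 1 (fun t : R => t *: v + x) v.
Proof.
apply: is_derive_rV => i; under eq_fun do rewrite !mxE.
by apply: is_derive_eq; rewrite /GRing.scale/=; ring.
Qed.

Lemma sum_delta (i : 'I_N) (a : 'I_N -> R) :
  \sum_j a j * (delta_mx 0 i : 'rV[R]_N) 0 j = a i.
Proof.
rewrite (bigD1 i)//= mxE !eqxx mulr1 big1 ?addr0// => j ji.
by rewrite mxE (negbTE ji) andbF mulr0.
Qed.

Lemma is_derive_conformal_factor c t v : poincare_ball (c t) -> is_derive t 1 c v ->
  is_derive t 1 (fun s => conformal_factor (c s))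
    (conformal_factor (c t) ^+ 2 * \sum_i c t 0 i * v 0 i).
Proof.
move=> Ut dc; have ds := is_derive_sqnorm dc.
have h1 : is_derive t 1 (fun=> 2 : R) 0 by exact: is_derive_cst.
have h2 : is_derive t 1 (fun s => 1 - sqnorm (c s)) (- (2 * \sum_i c t 0 i * v 0 i)).
  by apply: is_derive_eq; ring.
have h0 : 1 - sqnorm (c t) != 0 by rewrite gt_eqF// subr_gt0.
have := @is_derive_div R (fun=> 2) (fun s => 1 - sqnorm (c s)) _ _ _ h0 h1 h2.
by move/is_derive_eq; apply; rewrite /conformal_factor; field.
Qed.

Lemma is_derive_sqr_conformal_factor (i : 'I_N) x : poincare_ball x ->
  is_derive x (delta_mx 0 i) (fun y => conformal_factor y ^+ 2)
    (2 * conformal_factor x ^+ 3 * x 0 i).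
Proof.
move=> Ux; apply: is_derive_line.
have := @is_derive_conformal_factor (fun t : R => t *: delta_mx 0 i + x) 0 (delta_mx 0 i).
rewrite !scale0r !add0r sum_delta => /(_ Ux (is_derive_line_id _ _)) dcf.
apply: (@is_derive_eq _ _ _ (fun t : R => conformal_factor (t *: delta_mx 0 i + x) ^+ 2)).
by rewrite /= scale0r add0r /GRing.scale/=; ring.
Qed.

End partial_derivatives.

Section linear_ode.
Context {R : realType}.

(** The combinations m + k y and m - k y solve first-order equations, so that
    multiplying them by exponentials gives constants; this yields uniqueness
    with no general theorem on differential equations. *)
Lemma linear_ode (y m : R -> R) (k : R) : k != 0 ->
  (forall t : R, is_derive t 1 y (m t)) ->
  (forall t : R, is_derive t 1 m (k ^+ 2 * y t)) ->
  forall t, y t = y 0 * cosh (k * t) + m 0 / k * sinh (k * t).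
Proof.
move=> k0 dy dm t.
have key (e : R) (e2 : e ^+ 2 = 1) s :
    expR (- (e * k * s)) * (m s + e * k * y s) = m 0 + e * k * y 0.
  pose z s := expR (- (e * k * s)) * (m s + e * k * y s).
  have dz (s' : R) : is_derive s' 1 z 0.
    have d1 : is_derive s' 1 (fun s => - (e * k * s)) (- (e * k)).
      by apply: is_derive_eq; rewrite /GRing.scale/=; ring.
    have d2 := @is_derive1_comp R expR (fun s => - (e * k * s)) s' _ _ (is_derive_expR _) d1.
    have d3 := dy s'; have d4 := dm s'.
    apply: (@is_derive_eq _ _ _ z).
    rewrite /GRing.scale/=.
    transitivity ((1 - e ^+ 2) * expR (- (e * k * s')) * (k ^+ 2 * y s')); first ring.
    by rewrite e2 subrr !mul0r.
  rewrite -[LHS]/(z s) (is_derive_0_is_cst s 0 dz) /z.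
  by rewrite mulr0 oppr0 expR0 mul1r.
have sN1 : (-1 : R) ^+ 2 = 1 by ring.
have /(canRL (mulKf _)) := key 1 (expr1n _ _) t.
have /(canRL (mulKf _)) := key (-1) sN1 t.
rewrite !gt_eqF ?expR_gt0// => /(_ isT) h1 /(_ isT) h2.
have {}h1 : m t - k * y t = expR (- (k * t)) * (m 0 - k * y 0).
  by move: h1; rewrite -expRN opprK !mulN1r !mulNr.
have {}h2 : m t + k * y t = expR (k * t) * (m 0 + k * y 0).
  by move: h2; rewrite -expRN opprK !mul1r.
have : 2 * k * y t = expR (k * t) * (m 0 + k * y 0) - expR (- (k * t)) * (m 0 - k * y 0).
  by rewrite -h1 -h2; ring.
move=> h; apply: (@mulfI _ (2 * k)); first by rewrite mulf_neq0// pnatr_eq0.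
by rewrite h /cosh /sinh; field.
Qed.

End linear_ode.

Section exponential_map.
Context {R : realType} {N : nat}.
Implicit Types (F : 'rV[R]_N -> R) (c : R -> 'rV[R]_N) (x v : 'rV[R]_N) (t : R).

Lemma christoffel_poincare x (k i j : 'I_N) : poincare_ball x ->
  christoffel poincare_metric x k i j =
  conformal_factor x * (x 0 i * (j == k)%:R + x 0 j * (i == k)%:R - x 0 k * (i == j)%:R).
Proof.
move=> Ux; rewrite /christoffel invmx_poincare//.
have pg (a b l : 'I_N) : partial a (fun y => poincare_metric y b l) x =
    2 * conformal_factor x ^+ 3 * x 0 a * (b == l)%:R.
  rewrite /partial (_ : (fun y => poincare_metric y b l) =
      (fun y => conformal_factor y ^+ 2 * (b == l)%:R)); last first.
    by apply/funext => y; rewrite mxE mulr_natr.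
  have dcf := is_derive_sqr_conformal_factor a Ux.
  have dk : is_derive x (delta_mx 0 a) (fun y => conformal_factor y ^+ 2 * (b == l)%:R)
      (2 * conformal_factor x ^+ 3 * x 0 a * (b == l)%:R).
    by apply: is_derive_eq; rewrite /GRing.scale/=; ring.
  exact: derive_val.
under eq_bigr do rewrite !pg mxE.
rewrite (bigD1 k)//= eqxx big1 ?addr0; last first.
  by move=> l lk; rewrite [k == l]eq_sym (negbTE lk) mulr0n mul0r.
rewrite mulr1n; have := conformal_factor_gt0 Ux => c0.
by field; rewrite gt_eqF.
Qed.

(** With this sum the geodesic equation reads
    c'' = cf (|c'|^2 c - 2 <c, c'> c'), where cf is the conformal factor at c. *)
Lemma christoffel_sum x v (k : 'I_N) : poincare_ball x ->
  \sum_i \sum_j christoffel poincare_metric x k i j * v 0 i * v 0 j =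
  conformal_factor x * (2 * (\sum_i x 0 i * v 0 i) * v 0 k - x 0 k * sqnorm v).
Proof.
move=> Ux.
have pick (a : 'I_N -> R) : \sum_j a j * (j == k)%:R = a k.
  rewrite (bigD1 k)//= eqxx mulr1 big1 ?addr0// => j jk.
  by rewrite (negbTE jk) mulr0.
transitivity (\sum_i (conformal_factor x * (x 0 i * v 0 i * v 0 k +
    (\sum_j x 0 j * v 0 j) * (v 0 i * (i == k)%:R) - x 0 k * v 0 i ^+ 2))).
  apply: eq_bigr => i _.
  transitivity (\sum_j (conformal_factor x * (x 0 i * v 0 i * (v 0 j * (j == k)%:R)
      + (x 0 j * v 0 j) * (v 0 i * (i == k)%:R)
      - x 0 k * v 0 i * (v 0 j * (j == i)%:R)))).
    by apply: eq_bigr => j _; rewrite christoffel_poincare// (eq_sym i j); ring.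
  rewrite -mulr_sumr; congr *%R; rewrite sumrB big_split/= -!mulr_sumr -mulr_suml pick.
  congr (_ - _); rewrite (bigD1 i)//= eqxx mulr1 big1 ?addr0; last first.
    by move=> j ji; rewrite (negbTE ji) mulr0.
  by rewrite -mulrA expr2.
rewrite -mulr_sumr; congr *%R; rewrite sumrB big_split/= -!mulr_sumr -mulr_suml pick.
by rewrite -/(sqnorm v); ring.
Qed.

Lemma is_derive_dot c (d : R -> 'rV[R]_N) t v (w : 'rV[R]_N) : is_derive t 1 c v -> is_derive t 1 d w ->
  is_derive t 1 (fun s => \sum_i c s 0 i * d s 0 i)
    (\sum_i (v 0 i * d t 0 i + c t 0 i * w 0 i)).
Proof.
move=> dc dd.
have := @is_derive_sum R R R N (fun i s => c s 0 i * d s 0 i) t 1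
  (fun i => v 0 i * d t 0 i + c t 0 i * w 0 i).
rewrite (_ : \sum_i _ = (fun s => \sum_i c s 0 i * d s 0 i)); last first.
  by apply/funext => s; rewrite fct_sumE.
apply=> i; have dci := is_derive_coord i dc; have ddi := is_derive_coord i dd.
by apply: is_derive_eq; rewrite /GRing.scale/=; ring.
Qed.

(** A geodesic from the centre is determined by its velocity. Along it, the
    conformal factor l and the squared speed satisfy (l^2 |c'|^2)' = 0, so the
    speed is a constant k = 2 |v|, and both l - 1 and the l c_i solve
    y'' = k^2 y: these are the coordinates of the hyperboloid model, in which
    geodesics are plane sections. *)
Lemma geodesic_end c v : v != 0 -> geodesic poincare_ball poincare_metric c ->
  c 0 = 0 -> derive1 c 0 = v ->
  c 1 = (tanh_half (2 * euclid_norm v) / euclid_norm v) *: v.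
Proof.
move=> v0 gc c0 c'0; have nv := euclid_norm_gt0 v0.
have U t : poincare_ball (c t) by have [Uct _ _ _] := gc t.
have dc (t : R) : is_derive t 1 c (derive1 c t).
  by have [_ dct _ _] := gc t; rewrite derive1E; exact: derivableP.
have da (t : R) : is_derive t 1 (derive1 c) (derive1 (derive1 c) t).
  by have [_ _ dat _] := gc t; rewrite [X in is_derive _ _ _ X]derive1E; exact: derivableP.
have geo t k : derive1 (derive1 c) t 0 k = conformal_factor (c t) *
    (c t 0 k * sqnorm (derive1 c t) -
     2 * (\sum_i c t 0 i * derive1 c t 0 i) * derive1 c t 0 k).
  have [_ _ _ /(_ k)] := gc t; rewrite christoffel_sum// => /eqP.
  by rewrite addr_eq0 => /eqP ->; ring.
move: dc da geo c'0; move: (derive1 c) (derive1 (derive1 c)) => a b dc da geo a0.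
pose l t := conformal_factor (c t).
pose P t := \sum_i c t 0 i * a t 0 i.
pose Q t := \sum_i a t 0 i * a t 0 i.
have bE t k : b t 0 k = l t * (c t 0 k * Q t - 2 * P t * a t 0 k).
  by rewrite geo (_ : sqnorm (a t) = Q t)//; apply: eq_bigr => i _; rewrite expr2.
pose S t := sqnorm (c t).
have SE t : l t * S t = l t - 2.
  rewrite /l /S /conformal_factor; have := U t; rewrite /poincare_ball/= => St.
  by field; rewrite gt_eqF// subr_gt0.
have SS t : \sum_i c t 0 i * c t 0 i = S t by apply: eq_bigr => i _; rewrite expr2.
have dl (t : R) : is_derive t 1 l (l t ^+ 2 * P t) by exact: is_derive_conformal_factor.
have dP (t : R) : is_derive t 1 P (Q t + l t * (S t * Q t - 2 * P t ^+ 2)).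
  apply: (is_derive_eq (is_derive_dot (dc t) (da t))).
  transitivity (\sum_i (a t 0 i * a t 0 i + (l t * Q t * (c t 0 i * c t 0 i) +
      (- 2 * l t * P t) * (c t 0 i * a t 0 i)))).
    by apply: eq_bigr => i _; rewrite bE; ring.
  by rewrite !big_split/= -!mulr_sumr SS -/(P t) -/(Q t); ring.
have dQ (t : R) : is_derive t 1 Q (- (2 * l t * P t * Q t)).
  apply: (is_derive_eq (is_derive_dot (da t) (da t))).
  transitivity (\sum_i (2 * l t * Q t * (c t 0 i * a t 0 i) +
      (- 4 * l t * P t) * (a t 0 i * a t 0 i))).
    by apply: eq_bigr => i _; rewrite bE; ring.
  by rewrite !big_split/= -!mulr_sumr -/(P t) -/(Q t); ring.
pose k := 2 * euclid_norm v.
have k0 : k != 0 by rewrite gt_eqF// mulr_gt0.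
pose M t := l t ^+ 2 * P t.
have l0 : l 0 = 2.
  rewrite /l c0 /conformal_factor (_ : sqnorm 0 = 0) ?subr0 ?divr1//.
  by apply/eqP; rewrite sqnorm_eq0.
have P0 : P 0 = 0 by rewrite /P c0 big1// => i _; rewrite mxE mul0r.
have Q0 : Q 0 = sqnorm v by rewrite /Q a0; apply: eq_bigr => i _; rewrite expr2.
have E t : l t ^+ 2 * Q t = k ^+ 2.
  have dE (s : R) : is_derive s 1 (fun s => l s ^+ 2 * Q s) 0.
    have := dl s; have := dQ s => ? ?.
    by apply: is_derive_eq; rewrite /GRing.scale/=; ring.
  rewrite (is_derive_0_is_cst t 0 dE) l0 Q0 /k exprMn sqr_euclid_norm; ring.
have dM (t : R) : is_derive t 1 M (k ^+ 2 * (l t - 1)).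
  have := dl t; have := dP t => ? ?.
  apply: is_derive_eq; rewrite /GRing.scale/= -(E t).
  transitivity (l t ^+ 2 * Q t * (1 + l t * S t)); first ring.
  by rewrite SE; ring.
have lE : l 1 = 1 + cosh k.
  have dy (s : R) : is_derive s 1 (fun s => l s - 1) (M s).
    by have := dl s => ?; apply: is_derive_eq; rewrite /M; ring.
  have := linear_ode k0 dy dM 1; rewrite /M l0 P0 mulr0 mul0r mul0r mulr1 addr0.
  by move=> /eqP; rewrite subr_eq => /eqP ->; ring.
have XE i : l 1 * c 1 0 i = 2 * v 0 i / k * sinh k.
  have dX (s : R) : is_derive s 1 (fun s => l s * c s 0 i)
      (M s * c s 0 i + l s * a s 0 i).
    have := dl s; have := is_derive_coord i (dc s) => ? ?.
    by apply: is_derive_eq; rewrite /GRing.scale/= /M; ring.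
  have dY (s : R) : is_derive s 1 (fun s => M s * c s 0 i + l s * a s 0 i)
      (k ^+ 2 * (l s * c s 0 i)).
    have := dl s; have := is_derive_coord i (dc s); have := dM s.
    have := is_derive_coord i (da s) => d1 d2 d3 d4.
    apply: (is_derive_eq (is_deriveD (is_deriveM d2 d3) (is_deriveM d4 d1))).
    rewrite /GRing.scale/= bE -(E s) /M; ring.
  have := linear_ode k0 dX dY 1.
  by rewrite /M l0 P0 c0 mxE !mulr0 mul0r add0r mulr1 a0 add0r.
apply/rowP => i; have ek := expR_gt0 k.
have l1 : l 1 != 0 by rewrite gt_eqF// conformal_factor_gt0.
apply: (mulfI l1); rewrite XE mxE lE -/k /tanh_half /cosh /sinh expRN /k.
have nv0 : euclid_norm v != 0 by rewrite gt_eqF.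
field; rewrite -/k; apply/and3P; split => //; rewrite gt_eqF//; lra.
Qed.

End exponential_map.

Section radial_derivative.
Context {R : realType} {N : nat}.
Implicit Types (F : 'rV[R]_N -> R) (x v : 'rV[R]_N).

(** Existence of the geodesic whose end point is given by [geodesic_end]. *)
Lemma geodesic_ray v : v != 0 ->
  let k := 2 * euclid_norm v in
  let c := fun t : R => (tanh_half (k * t) / euclid_norm v) *: v in
  [/\ geodesic poincare_ball poincare_metric c, c 0 = 0 & derive1 c 0 = v].
Proof.
move=> v0 k c; have nv := euclid_norm_gt0 v0; have nv0 : euclid_norm v != 0 by rewrite gt_eqF.
pose T t := tanh_half (k * t).
pose T1 t := k * (1 - T t ^+ 2) / 2.
have dT (t : R) : is_derive t 1 T (T1 t).
  have d1 : is_derive t 1 (fun s : R => k * s) k.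
    by apply: is_derive_eq; rewrite /GRing.scale/=; ring.
  have := @is_derive1_comp R tanh_half (fun s => k * s) t _ _ (is_derive_tanh_half _) d1.
  by move/is_derive_eq; apply; rewrite /T1 /T; ring.
have dT1 (t : R) : is_derive t 1 T1 (- k * T t * T1 t).
  have := dT t => ?.
  have : is_derive t 1 (fun s => k * (1 - T s ^+ 2) / 2) (- k * T t * T1 t).
    by apply: is_derive_eq; rewrite /GRing.scale/=; field.
  by [].
have dscale (g : R -> R) (d t : R) : is_derive t 1 g d ->
    is_derive t 1 (fun s => (g s / euclid_norm v) *: v) ((d / euclid_norm v) *: v).
  move=> dg; apply: is_derive_rV => i; under eq_fun do rewrite mxE.
  by rewrite mxE; apply: is_derive_eq; rewrite /GRing.scale/=; ring.
have c'E : derive1 c = fun t => (T1 t / euclid_norm v) *: v.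
  apply/funext => t; rewrite derive1E.
  exact: (@derive_val _ _ _ _ _ _ _ (dscale _ _ _ (dT t))).
have c''E : derive1 (derive1 c) = fun t => (- k * T t * T1 t / euclid_norm v) *: v.
  rewrite c'E; apply/funext => t; rewrite derive1E.
  exact: (@derive_val _ _ _ _ _ _ _ (dscale _ _ _ (dT1 t))).
have T0 : T 0 = 0 by rewrite /T mulr0 /tanh_half expR0 subrr mul0r.
have cn t : sqnorm (c t) = T t ^+ 2.
  by rewrite /c sqnormZ -sqr_euclid_norm -/(T t); field.
have Uc t : poincare_ball (c t).
  rewrite /poincare_ball/= cn; have /andP[] := tanh_half_itv (k * t).
  by rewrite -/(T t) => ? ?; nra.
split.
- move=> t; split.
  + exact: Uc.
  + by have [dc _] := dscale _ _ _ (dT t).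
  + by rewrite c'E; have [dc _] := dscale _ _ _ (dT1 t).
  + move=> i; rewrite christoffel_sum// c''E c'E /= /conformal_factor cn.
  rewrite sqnormZ -sqr_euclid_norm.
  rewrite (_ : \sum_i0 _ = T t * T1 t); last first.
    transitivity (\sum_i0 (T t * T1 t / euclid_norm v ^+ 2) * v 0 i0 ^+ 2).
      by apply: eq_bigr => j _; rewrite /c !mxE -/(T t); field.
    by rewrite -mulr_sumr -/(sqnorm v) -sqr_euclid_norm; field.
  rewrite /c !mxE -/(T t) {2 3}/T1.
  have /andP[h1 h2] := tanh_half_itv (k * t); rewrite -/(T t) in h1 h2.
  by rewrite /T1; field; rewrite nv0/= gt_eqF//; nra.
- by rewrite /c -/(T 0) T0 mul0r scale0r.
- rewrite c'E /T1 T0 /k.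
  rewrite (_ : _ / euclid_norm v = 1) ?scale1r//; field; exact: nv0.
Qed.

Lemma exp_mapE v : v != 0 ->
  exp_map poincare_ball poincare_metric 0 v =
  (tanh_half (2 * euclid_norm v) / euclid_norm v) *: v.
Proof.
move=> v0; apply: xget_unique.
  have [gc c0 c'0] := geodesic_ray v0.
  exists (fun t : R => (tanh_half (2 * euclid_norm v * t) / euclid_norm v) *: v).
  by split => //; rewrite mulr1.
by move=> y [c [gc c0 c'0 <-]]; exact: geodesic_end.
Qed.

Lemma hyp_rho_gt0 x : poincare_ball x -> x != 0 -> 0 < hyp_rho x.
Proof.
move=> Ux x0; rewrite hyp_rhoE//; have r0 := euclid_norm_gt0 x0.
have /andP[_ r1] := euclid_norm_itv Ux.
by rewrite ln_gt0// ltr_pdivlMr; lra.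
Qed.

Lemma radial_directionE x : poincare_ball x -> x != 0 ->
  radial_direction poincare_ball poincare_metric 0 x = (2 * euclid_norm x)^-1 *: x.
Proof.
move=> Ux x0; have r0 := euclid_norm_gt0 x0; have rho0 := hyp_rho_gt0 Ux x0.
have th : tanh_half (hyp_rho x) = euclid_norm x.
  by rewrite hyp_rhoE// tanh_half_hyp_radius// euclid_norm_itv.
have U0 : poincare_ball (0 : 'rV[R]_N).
  by apply/poincare_ballE; rewrite -(scale0r 0) euclid_normZ normr0 mul0r.
have mn (u : 'rV[R]_N) : metric_norm poincare_metric 0 u = 2 * euclid_norm u.
  rewrite metric_norm_poincare// /conformal_factor (_ : sqnorm 0 = 0) ?subr0 ?divr1//.
  by apply/eqP; rewrite sqnorm_eq0.
have ex (u : 'rV[R]_N) : 2 * euclid_norm u = 1 ->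
    exp_map poincare_ball poincare_metric 0 (hyp_rho x *: u) = (2 * euclid_norm x) *: u.
  move=> u1.
  have u0 : u != 0.
    apply: contra_eq_neq u1 => ->.
    by rewrite -(scale0r 0) euclid_normZ normr0 mul0r mulr0 eq_sym oner_neq0.
  rewrite exp_mapE ?scaler_eq0 ?negb_or ?u0 ?gt_eqF// euclid_normZ gtr0_norm//.
  rewrite mulrCA u1 mulr1 th scalerA; congr (_ *: _).
  have -> : euclid_norm u = 2^-1 by lra.
  by field; rewrite gt_eqF.
apply: xget_unique.
- have n1 : 2 * euclid_norm ((2 * euclid_norm x)^-1 *: x) = 1.
    rewrite euclid_normZ ger0_norm ?invr_ge0 ?mulr_ge0 ?ltW//.
    by field; rewrite gt_eqF.
  rewrite /= mn n1 -/(hyp_rho x) ex//; split => //.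
  by rewrite scalerA divff ?scale1r// gt_eqF// mulr_gt0.
- move=> u /=; rewrite mn -/(hyp_rho x) => -[u1]; rewrite ex// => <-.
  rewrite euclid_normZ ger0_norm ?mulr_ge0 ?ltW// scalerA.
  rewrite (_ : _ * _ = 1) ?scale1r//.
  have -> : euclid_norm u = 2^-1 by lra.
  by field; rewrite gt_eqF.
Qed.

(** Only positive times matter near t = rho x, which spares computing the
    exponential of the zero vector. The derivative is taken along the ray alone,
    because F will involve a power of rho. *)
Lemma is_derive_hyp_radial F x d : poincare_ball x -> x != 0 ->
  is_derive (hyp_rho x) 1
    (fun t : R => F ((tanh_half t / euclid_norm x) *: x)) d ->
  hyp_radial F x = d.
Proof.
move=> Ux x0 dF; have r0 := euclid_norm_gt0 x0; have rho0 := hyp_rho_gt0 Ux x0.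
rewrite /hyp_radial /radial_derivative radial_directionE// derive1E -/(hyp_rho x).
apply: (@derive_val _ _ _ _ _ _ _ (near_eq_is_derive _ dF)).
near=> t.
have t0 : 0 < t by near: t; exact: lt_nbhsr.
congr F; rewrite scalerA exp_mapE; last first.
  by rewrite scaler_eq0 negb_or x0 mulf_neq0// ?invr_eq0 ?mulf_neq0// gt_eqF.
rewrite euclid_normZ ger0_norm ?mulr_ge0 ?invr_ge0 ?mulr_ge0 ?ltW//.
rewrite scalerA (_ : 2 * _ = t); last by field; rewrite gt_eqF.
by congr (_ *: _); field; rewrite !gt_eqF.
Unshelve. all: by end_near. Qed.

Lemma is_derive_ray x (t : R) :
  is_derive t 1 (fun s : R => (tanh_half s / euclid_norm x) *: x)
    (((1 - tanh_half t ^+ 2) / 2 / euclid_norm x) *: x).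
Proof.
apply: is_derive_rV => i; have := is_derive_tanh_half t => ?.
under eq_fun do rewrite mxE.
by rewrite mxE; apply: is_derive_eq; rewrite /GRing.scale/=; ring.
Qed.

Lemma hyp_radialE F x : poincare_ball x -> x != 0 -> differentiable F x ->
  hyp_radial F x =
  (\sum_i x 0 i * partial i F x) / (conformal_factor x * euclid_norm x).
Proof.
move=> Ux x0 dF; have r0 := euclid_norm_gt0 x0.
have th : tanh_half (hyp_rho x) = euclid_norm x.
  by rewrite hyp_rhoE// tanh_half_hyp_radius// euclid_norm_itv.
apply: is_derive_hyp_radial => //.
have xE : (tanh_half (hyp_rho x) / euclid_norm x) *: x = x.
  by rewrite th divff ?scale1r// gt_eqF.
have := @is_derive_comp_curve R N F (fun s : R => (tanh_half s / euclid_norm x) *: x)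
  (hyp_rho x) _ _ (is_derive_ray x (hyp_rho x)).
rewrite xE => /(_ dF) /is_derive_eq; apply.
rewrite th sqr_euclid_norm mulr_suml; apply: eq_bigr => i _.
rewrite mxE /conformal_factor; move: Ux; rewrite /poincare_ball/= => Ux.
by field; rewrite !gt_eqF// subr_gt0.
Qed.

End radial_derivative.

(** * Borel functions and dilations on tuples *)

Section borel_tuple.
Context {R : realType} {n : nat}.
Local Notation mR := (measurableTypeR R).

Definition tuple_vec (t : n.-tuple mR) : 'rV[R]_n := \row_i tnth t i.

(** The product sigma-algebra contains the open sets because they are countable
    unions of rational boxes. *)
Lemma measurable_preimage_open (A : set 'rV[R]_n) : open A -> measurable (tuple_vec @^-1` A).
Proof.
move=> oA.
pose box (qk : 'rV[rat]_n * nat) : set 'rV[R]_n :=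
  [set y | forall i, `|y 0 i - ratr (qk.1 0 i)| < qk.2.+1%:R^-1].
have -> : tuple_vec @^-1` A = \bigcup_(qk in [set qk | box qk `<=` A]) (tuple_vec @^-1` box qk).
  apply/seteqP; split => [t At|t [qk /= qkA tqk]]; last exact: qkA.
  have /nbhs_ballP[e /= e0 eA] : nbhs (tuple_vec t) A by move: oA; rewrite openE; exact.
  have [k ke] : exists k, k.+1%:R^-1 < e / 2.
    exists (Num.truncn (e / 2)^-1).
    by rewrite invf_plt ?posrE ?divr_gt0// truncnS_gt.
  have [q qP] : exists q : 'I_n -> rat, forall i, `|tuple_vec t 0 i - ratr (q i)| < k.+1%:R^-1.
    have k0 : 0 < k.+1%:R^-1 :> R by rewrite invr_gt0.
    move: (k.+1%:R^-1) k0 => d d0.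
    have h i : exists q : rat, `|tuple_vec t 0 i - ratr q| < d.
      have [r] := rat_in_itvoo (ltr_pwDr d0 (lexx (tuple_vec t 0 i))).
      rewrite in_itv/= => /andP[r1 r2]; exists r.
      by rewrite ltr_norml; apply/andP; split; lra.
    by exists (fun i => sval (cid (h i))) => i; case: cid.
  exists (\row_i q i, k) => /=; last by move=> i; rewrite !mxE; have := qP i; rewrite mxE.
  move=> y yq; apply: eA; split => // i j; rewrite ord1.
  have := yq j; rewrite mxE => yj; have := qP j => tj.
  apply: (@le_lt_trans _ _ (`|tuple_vec t 0 j - ratr (q j)| + `|y 0 j - ratr (q j)|)).
    rewrite [`|y 0 j - _|]distrC; apply: le_trans (ler_normD _ _).
    by rewrite addrA subrK.
  by move: ke tj yj; set d := k.+1%:R^-1; lra.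
rewrite bigcup_mkcond; apply: countable_bigcupT_measurable => // -[q k].
case: ifPn => // _.
rewrite (_ : _ @^-1` _ = \bigcap_(i in [set: 'I_n])
    (fun t : n.-tuple mR => `|tnth t i - ratr (q 0 i)|) @^-1` [set r | r < k.+1%:R^-1]).
  apply: fin_bigcap_measurable => // i _.
  rewrite -[X in measurable X]setTI.
  have mf : measurable_fun [set: n.-tuple mR] (fun t : n.-tuple mR => `|tnth t i - ratr (q 0 i)|).
    apply: measurableT_comp => //; apply: measurable_funB => //.
    exact: measurable_tnth.
  apply: mf => //.
  by rewrite (_ : [set r | _] = `]-oo, k.+1%:R^-1[%classic)// set_itvE.
apply/seteqP; split => t /= h i; first by have := h i; rewrite mxE.
by rewrite mxE; exact: h.
Qed.

Lemma measurable_tuple_vec_open (O : set 'rV[R]_n) (G : 'rV[R]_n -> R) :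
  open O -> (forall x, O x -> {for x, continuous G}) ->
  measurable_fun (tuple_vec @^-1` O) (fun t => G (tuple_vec t)).
Proof.
move=> oO cG mD; apply: (measurability _ (RGenOInfty.measurableE R)) => // _ [_ [r ->] <-].
rewrite (_ : _ `&` _ = tuple_vec @^-1` (O `&` G @^-1` `]r, +oo[%classic)); last first.
  by apply/seteqP; split.
apply: measurable_preimage_open.
rewrite openE => x [Ox Gx]; rewrite /interior; apply: filterI.
  by move: oO; rewrite openE; exact.
apply: (cG _ Ox); apply: open_nbhs_nbhs; split.
  exact: interval_open.
exact: Gx.
Qed.

(** Integrands live on an open set on which they are continuous; extending them
    by 0 lets dilations, which do not preserve that set, act on them. *)
Definition zero_ext (O : set 'rV[R]_n) (G : 'rV[R]_n -> R) (t : n.-tuple mR) : R :=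
  if tuple_vec t \in O then G (tuple_vec t) else 0.

Lemma measurable_zero_ext (O : set 'rV[R]_n) (G : 'rV[R]_n -> R) :
  open O -> (forall x, O x -> {for x, continuous G}) ->
  measurable_fun setT (zero_ext O G).
Proof.
move=> oO cG; have mO := measurable_preimage_open oO.
rewrite (_ : zero_ext O G = (fun t => G (tuple_vec t)) \_ (tuple_vec @^-1` O)).
  by apply/measurable_restrict => //; rewrite setTI; exact: measurable_tuple_vec_open.
apply/funext => t; rewrite /zero_ext patchE.
by rewrite (_ : (t \in _) = (tuple_vec t \in O)).
Qed.

End borel_tuple.

Section scaling.
Context {R : realType}.
Local Notation mR := (measurableTypeR R).
Local Notation leb := (@lebesgue_measure R).

Lemma ge0_integral_tupleS n (F : n.+1.-tuple mR -> \bar R) :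
  measurable_fun setT F -> (forall t, (0 <= F t)%E) ->
  (\int[lebesgue_tuple n.+1]_t F t =
   \int[leb]_x \int[lebesgue_tuple n]_t F (cons_pair (x, t)))%E.
Proof.
move=> mF F0.
have E := @ge0_integral_pushforward _ _ _ _ R (@cons_pair R n) (@measurable_cons_pair R n)
  (leb \x lebesgue_tuple n)%E setT F measurableT mF (fun t _ => F0 t).
rewrite preimage_setT in E; etransitivity; first exact: E.
rewrite fubini_tonelli1//=.
by apply: measurableT_comp => //; exact: measurable_cons_pair.
Qed.

Lemma ge0_integral_scale1 (c : R) (f : mR -> \bar R) : 0 < c ->
  measurable_fun setT f -> (forall x, (0 <= f x)%E) ->
  (\int[leb]_x f (c * x)%R = (c^-1)%:E * \int[leb]_x f x)%E.
Proof.
move=> c0 mf f0.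
have mphi : measurable_fun setT (fun x : mR => c * x : mR) by exact: measurable_funM.
pose mphi_mixin := isMeasurableFun.Build _ _ _ _ _ mphi.
pose phi : {mfun mR >-> mR} := HB.pack (fun x : mR => c * x : mR) mphi_mixin.
have ci0 : 0 <= c^-1 by rewrite invr_ge0 ltW.
have H A : measurable A -> leb A = mscale (NngNum (ltW c0)) (pushforward leb phi) A.
  apply: lebesgue_measure_unique => _ [[a b]] _ <-.
  have P : phi @^-1` `]a, b]%classic = `]a / c, b / c]%classic.
    apply/seteqP; split => x; rewrite /= !in_itv/= ltr_pdivrMr// ler_pdivlMr//;
      by rewrite !(mulrC c).
  transitivity (c%:E * leb `](a / c)%R, (b / c)%R]%classic)%E; last by rewrite -P.
  rewrite !lebesgue_measure_itv/= !lte_fin ltr_pM2r ?invr_gt0//.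
  case: ifPn => // _; last by rewrite mule0.
  by rewrite -!EFinB -EFinM -mulrBl mulrCA divff ?mulr1// gt_eqF.
rewrite [in RHS](eq_measure_integral (mscale (NngNum (ltW c0)) (pushforward leb phi))); last first.
  by move=> A mA _; exact: H.
rewrite ge0_integral_mscale// muleA -EFinM mulVf ?gt_eqF// mul1e.
by rewrite ge0_integral_pushforward.
Qed.

Definition scale_tuple n (c : R) (t : n.-tuple mR) : n.-tuple mR :=
  [tuple of map (fun x => c * x) t].

Lemma measurable_scale_tuple n c : measurable_fun setT (@scale_tuple n c).
Proof.
apply/measurable_fun_tnthP => i.
rewrite (_ : _ \o _ = fun t => c * tnth t i); last first.
  by apply/funext => t /=; rewrite tnth_map.
by apply: measurable_funM => //; exact: measurable_tnth.
Qed.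

(** Scaling of Lebesgue measure, one coordinate at a time by Tonelli's theorem. *)
Lemma ge0_integral_scale n (c : R) (F : n.-tuple mR -> \bar R) : 0 < c ->
  measurable_fun setT F -> (forall t, (0 <= F t)%E) ->
  (\int[lebesgue_tuple n]_t F (scale_tuple c t) =
   (c ^- n)%:E * \int[lebesgue_tuple n]_t F t)%E.
Proof.
move=> c0; elim: n F => [|n IH] F mF F0.
  rewrite expr0 invr1 mul1e; apply: eq_integral => t _.
  by rewrite (tuple0 t) (tuple0 (scale_tuple c _)).
rewrite ge0_integral_tupleS//; last first.
  by apply: measurableT_comp => //; exact: measurable_scale_tuple.
pose G x := (\int[lebesgue_tuple n]_t F (cons_pair (x, t)))%E.
have mFc : measurable_fun setT (fun p : mR * n.-tuple mR => F (cons_pair p)).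
  by apply: measurableT_comp => //; exact: measurable_cons_pair.
have mG : measurable_fun setT G.
  exact: (measurable_fun_fubini_tonelli_F (fun p => F (cons_pair p))).
transitivity (\int[leb]_x ((c ^- n)%:E * G (c * x)%R))%E.
  apply: eq_integral => x _; rewrite /G -IH//.
  - apply: eq_integral => t _; congr F; apply/val_inj; by [].
  - exact: (measurable_fun_pair2 (c * x) mFc).
rewrite ge0_integralZl//; last 3 first.
- by apply: measurableT_comp => //; exact: measurable_funM.
- by move=> x _; apply: integral_ge0.
- by rewrite lee_fin invr_ge0 exprn_ge0// ltW.
rewrite ge0_integral_scale1//; last by move=> x; apply: integral_ge0.
by rewrite muleA -EFinM ge0_integral_tupleS// -invfM -exprSr.
Qed.

End scaling.

Section dilation.
Context {R : realType} {n : nat}.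
Local Notation mR := (measurableTypeR R).
Local Notation leb := (@lebesgue_measure R).
Local Notation mu := (@lebesgue_tuple R n).

Lemma tuple_vec_scale (c : R) (t : n.-tuple mR) : tuple_vec (scale_tuple c t) = c *: tuple_vec t.
Proof. by apply/rowP => i; rewrite !mxE tnth_map. Qed.

Lemma integral_scale (c : R) (F : n.-tuple mR -> \bar R) : 0 < c ->
  mu.-integrable setT F ->
  (\int[mu]_t F (scale_tuple c t) = (c ^- n)%:E * \int[mu]_t F t)%E.
Proof.
move=> c0 iF; have mF := measurable_int mu iF.
rewrite -[LHS]/(integral mu setT (F \o scale_tuple c)) integralE [in RHS]integralE.
rewrite funepos_comp funeneg_comp /=.
rewrite (@ge0_integral_scale _ _ _ (F^\+)%E)//; last exact: measurable_funepos.
rewrite (@ge0_integral_scale _ _ _ (F^\-)%E)//; last exact: measurable_funeneg.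
by rewrite [RHS]muleBr//; exact: integrable_add_def.
Qed.

Lemma integrable_scale (c : R) (F : n.-tuple mR -> \bar R) : 0 < c ->
  mu.-integrable setT F -> mu.-integrable setT (fun t => F (scale_tuple c t)).
Proof.
move=> c0 /integrableP[mF oF]; apply/integrableP; split.
  by apply: measurableT_comp => //; exact: measurable_scale_tuple.
rewrite (@ge0_integral_scale _ _ _ (fun t => `|F t|)%E)//; last exact: measurableT_comp.
by rewrite lte_mul_pinfty// lee_fin invr_ge0 exprn_ge0// ltW.
Qed.

(** If D is the divergence of the radial field W(x) x, then
    d/ds (e^(n s) W (e^s x)) = e^(n s) D (e^s x). Integrate this over
    x and over s in [0, 1]. By scaling, the right-hand side gives the integral
    of D for every s, while the left-hand side gives the difference of two
    equal integrals of W. *)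
Lemma integral_dilation_derivative (W D : n.-tuple mR -> R) :
  mu.-integrable setT (EFin \o W) -> mu.-integrable setT (EFin \o D) ->
  (forall t (s : R), is_derive s 1
     (fun s => expR s ^+ n * W (scale_tuple (expR s) t))
     (expR s ^+ n * D (scale_tuple (expR s) t))) ->
  (forall t (s : R), {for s, continuous
     (fun s => expR s ^+ n * D (scale_tuple (expR s) t))}) ->
  (\int[mu]_t (D t)%:E = 0)%E.
Proof.
move=> iW iD dW cD.
have mD : measurable_fun setT D by apply/measurable_EFinP; exact: measurable_int iD.
pose g (s : R) (t : n.-tuple mR) : R := expR s ^+ n * D (scale_tuple (expR s) t).
pose Phi (p : mR * n.-tuple mR) : \bar R := ((g p.1 p.2)%:E * (\1_`[0%R, 1%R] p.1)%:E)%E.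
have mscale : measurable_fun setT
    (fun p : mR * n.-tuple mR => scale_tuple (expR p.1) p.2).
  apply/measurable_fun_tnthP => i.
  rewrite (_ : _ \o _ = fun p : mR * n.-tuple mR => expR p.1 * tnth p.2 i); last first.
    by apply/funext => p /=; rewrite tnth_map.
  apply: measurable_funM; first by apply: measurableT_comp.
  exact: (measurableT_comp (measurable_tnth i) measurable_snd).
have mg : measurable_fun setT (fun p : mR * n.-tuple mR => g p.1 p.2).
  apply: measurable_funM; last exact: measurableT_comp mD mscale.
  by apply: measurable_funX; apply: measurableT_comp.
have mPhi : measurable_fun setT Phi.
  apply: emeasurable_funM; first exact/measurable_EFinP.
  by apply/measurable_EFinP; apply: measurableT_comp.
have gE s (F : \bar R -> \bar R) (iF : mu.-integrable setT (F \o EFin \o D)) :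
    (\int[mu]_t ((expR s ^+ n)%:E * F (D (scale_tuple (expR s) t))%:E)
     = \int[mu]_t F (D t)%:E)%E.
  rewrite integralZl//; last first.
    exact: (@integrable_scale _ (F \o EFin \o D) (expR_gt0 s) iF).
  rewrite (@integral_scale _ (F \o EFin \o D) (expR_gt0 s) iF) muleA -EFinM.
  by rewrite divff ?mul1e// expf_neq0// gt_eqF// expR_gt0.
have I01 : (\int[leb]_s (\1_`[0%R, 1%R] s)%:E = 1)%E.
  by rewrite integral_indic// setIT /= lebesgue_measure_itv/= lte01 -EFinB subr0.
have iaD : mu.-integrable setT (abse \o EFin \o D) by exact: integrable_abse.
have [_ finD] := integrableP _ _ _ iD.
have iPhi : (leb \x mu)%E.-integrable setT Phi.
  apply/integrable12ltyP => //.
  rewrite (eq_integral (fun s : mR => (\int[mu]_t `|(D t)%:E|) * (\1_`[0%R, 1%R] s)%:E)%E).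
    rewrite ge0_integralZl//; last 2 first.
    - exact/measurable_EFinP.
    - exact: integral_ge0.
    by rewrite I01 mule1.
  move=> s _; rewrite -(gE s abse iaD) -ge0_integralZr//.
  - apply: eq_integral => t _.
    rewrite /Phi /g /= -!EFinM; congr (_%:E).
    rewrite !normrM [X in X * _ * _]ger0_norm ?exprn_ge0 ?expR_ge0//.
    by rewrite [X in _ * _ * X]ger0_norm.
  - apply: emeasurable_funM => //; apply/measurable_EFinP => /=.
    apply: measurableT_comp => //.
    exact: measurableT_comp mD (measurable_scale_tuple _).
have := Fubini iPhi.
have finI : (\int[mu]_t (D t)%:E)%E \is a fin_num by exact: integrable_fin_num.
rewrite (eq_integral (fun s : mR => (\int[mu]_t (D t)%:E) * (\1_`[0%R, 1%R] s)%:E)%E); last first.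
  move=> s _; rewrite -(gE s id iD) /Phi/= integralZr//.
  apply: (@eq_integrable _ _ _ mu setT measurableT
    (fun t => (expR s ^+ n)%:E * (EFin \o D) (scale_tuple (expR s) t))%E) => //.
  apply: integrableZl => //.
  exact: (@integrable_scale _ (EFin \o D) (expR_gt0 s) iD).
rewrite -(fineK finI) integralZl//; last first.
  by apply/integrableP; split; [exact/measurable_EFinP|
    under eq_integral do rewrite gee0_abs ?lee_fin//; rewrite I01 ltry].
rewrite I01 mule1 fineK// => ->.
transitivity (\int[mu]_t ((expR 1 ^+ n)%:E * (W (scale_tuple (expR 1) t))%:E - (W t)%:E))%E.
  apply: eq_integral => t _.
  transitivity (\int[leb]_(s in `[0%R, 1%R]) (g s t)%:E)%E.
    rewrite [RHS]integral_mkcond; apply: eq_integral => s _.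
    by rewrite /Phi patchE indicE/=; case: (s \in _); rewrite ?mule1 ?mule0.
  rewrite (@FTC2_01 _ (fun s => g s t) (fun s => expR s ^+ n * W (scale_tuple (expR s) t))).
  - rewrite expR0 expr1n mul1r EFinB EFinM; congr (_ - (W _)%:E)%E.
    by apply/eq_from_tnth => i; rewrite tnth_map mul1r.
  - by move=> s _; exact: cD.
have iWs : mu.-integrable setT (fun t => (expR 1 ^+ n)%:E * (W (scale_tuple (expR 1) t))%:E)%E.
  apply: integrableZl => //.
  exact: (@integrable_scale _ (EFin \o W) (expR_gt0 1) iW).
rewrite integralB//.
rewrite integralZl//; last exact: (@integrable_scale _ (EFin \o W) (expR_gt0 1) iW).
rewrite (@integral_scale _ (EFin \o W) (expR_gt0 1) iW) muleA -EFinM.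
rewrite divff ?mul1e; last by rewrite expf_neq0// gt_eqF// expR_gt0.
by rewrite subee//; exact: integrable_fin_num.
Qed.

End dilation.

(** * The inverse square on the ball *)

Section unit_ball.
Context {R : realType} {n : nat}.
Local Notation mR := (measurableTypeR R).
Local Notation mu := (@lebesgue_tuple R n).

Definition punctured_ball : set 'rV[R]_n := [set x | poincare_ball x /\ x != 0].

Lemma punctured_ballE (x : 'rV[R]_n) : punctured_ball x <-> 0 < sqnorm x < 1.
Proof.
rewrite /punctured_ball /poincare_ball/= sqnorm_gt0.
by split => [[-> ->]|/andP[]].
Qed.

Lemma open_punctured_ball : open punctured_ball.
Proof.
rewrite (_ : punctured_ball = (@sqnorm R n) @^-1` `]0, 1[%classic).
  apply: open_comp; last exact: interval_open.
  by move=> x _; exact: continuous_sqnorm.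
by apply/seteqP; split => x; rewrite punctured_ballE /= in_itv.
Qed.

Lemma tuple_vec_inj : injective (@tuple_vec R n).
Proof.
by move=> t t' /rowP h; apply/eq_from_tnth => i; have := h i; rewrite !mxE.
Qed.

Lemma measurable_origin : measurable (@tuple_vec R n @^-1` [set 0]).
Proof.
rewrite (_ : _ @^-1` _ = ~` (@tuple_vec R n @^-1` ((@sqnorm R n) @^-1` `]0, +oo[%classic))).
  apply: measurableC; apply: measurable_preimage_open.
  apply: open_comp; last exact: interval_open.
  by move=> x _; exact: continuous_sqnorm.
apply/seteqP; split => t /=; rewrite in_itv/= andbT sqnorm_gt0 => h.
  by rewrite h eqxx.
by apply/eqP/negPn/negP.
Qed.

End unit_ball.

Section measures.
Context {R : realType}.
Local Notation mR := (measurableTypeR R).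

(** The formulas for rho and for the radial derivative fail at the centre, but a
    point is negligible. *)
Lemma lebesgue_tuple_origin n : (0 < n)%N ->
  lebesgue_tuple n (@tuple_vec R n @^-1` [set 0]) = 0%E.
Proof.
case: n => // n _.
transitivity ((@lebesgue_measure R \x lebesgue_tuple n)%E
    ([set 0] `*` (@tuple_vec R n @^-1` [set 0]))).
  rewrite -[LHS]/((@lebesgue_measure R \x lebesgue_tuple n)%E
    (@cons_pair R n @^-1` (@tuple_vec R n.+1 @^-1` [set 0]))).
  congr (_ _); apply/seteqP; split => -[x t] /=.
    move=> /rowP h; split; first by have := h ord0; rewrite !mxE.
    apply/rowP => i; have := h (lift ord0 i); rewrite !mxE.
    by rewrite tnthS.
  move=> [-> /rowP h]; apply/rowP => i; rewrite !mxE.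
  have [->//|i0] := eqVneq i ord0.
  have /unlift_some[j -> _] : ord0 != i by rewrite eq_sym.
  by have := h j; rewrite !mxE tnthS.
rewrite product_measure1E//; last exact: measurable_origin.
by rewrite /= lebesgue_measure_set1 mul0e.
Qed.

Definition cube n : set (n.-tuple mR) := [set t | forall i, -1 <= tnth t i <= 1].

Lemma measurable_cube n : measurable (@cube n).
Proof.
rewrite (_ : @cube n = \bigcap_(i in [set: 'I_n])
    (fun t : n.-tuple mR => tnth t i) @^-1` `[-1, 1]%classic).
  apply: fin_bigcap_measurable => // i _.
  by rewrite -[X in measurable X]setTI; apply: (measurable_tnth i).
by apply/seteqP; split => t /= h i; have := h i; rewrite /= in_itv//=; exact.
Qed.

Lemma lebesgue_tuple_cube n : (lebesgue_tuple n (@cube n) < +oo)%E.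
Proof.
elim: n => [|n IH]; first by rewrite /= diracE ltry.
rewrite [ltLHS](_ : _ = (@lebesgue_measure R \x lebesgue_tuple n)%E
    (`[-1, 1]%classic `*` @cube n)).
  rewrite product_measure1E//; last exact: measurable_cube.
  rewrite /= lebesgue_measure_itv/= lte_fin ifT; last by rewrite (@lt_trans _ _ 0)// ltrN10.
  by rewrite -EFinB lte_mul_pinfty// lee_fin; lra.
rewrite -[LHS]/((@lebesgue_measure R \x lebesgue_tuple n)%E
    (@cons_pair R n @^-1` (@cube n.+1))).
congr (_ _); apply/seteqP; split => -[x t] /=.
  move=> h; split; first by have := h ord0; rewrite in_itv.
  by move=> i; have := h (lift ord0 i); rewrite tnthS.
rewrite in_itv/= => -[hx h] i.
have [->//|i0] := eqVneq i ord0.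
have /unlift_some[j -> _] : ord0 != i by rewrite eq_sym.
by have := h j; rewrite tnthS.
Qed.

Lemma lebesgue_tuple_ball n :
  (lebesgue_tuple n (@tuple_vec R n @^-1` poincare_ball) < +oo)%E.
Proof.
apply: le_lt_trans (lebesgue_tuple_cube n).
apply: le_measure; rewrite ?inE; [exact: measurable_preimage_open open_poincare_ball|
  exact: measurable_cube|].
move=> t /=; rewrite /poincare_ball/= => t1 i.
have : tnth t i ^+ 2 <= sqnorm (tuple_vec t).
  rewrite /sqnorm (bigD1 i)//= mxE lerDl; apply: sumr_ge0 => j _; exact: sqr_ge0.
by move=> h; apply/andP; split; nra.
Qed.

(** The truncations g_m = min (m, J) of J = 1 / r^2 on the unit ball B satisfy
    g_m (x) <= 4 1_B (x) + 4 g_m (2 x): the first term bounds J where r >= 1/2, and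
    J (x) = 4 J (2 x) elsewhere. Integrating, with 4 * 2^-n <= 1/2 when n >= 3,
    bounds the finite integral of g_m by 8 |B| uniformly in m, and monotone
    convergence concludes. *)
Lemma integrable_inv_sqnorm n : (3 <= n)%N ->
  (lebesgue_tuple n).-integrable setT
    (EFin \o zero_ext punctured_ball (fun x : 'rV[R]_n => (sqnorm x)^-1)).
Proof.
move=> n3; set mu := lebesgue_tuple n; set J := zero_ext _ _.
pose B := @tuple_vec R n @^-1` poincare_ball.
have mB : measurable B by exact: measurable_preimage_open open_poincare_ball.
have vB : mu B \is a fin_num.
  by rewrite ge0_fin_numE ?measure_ge0//; exact: lebesgue_tuple_ball.
pose q (t : n.-tuple mR) := sqnorm (tuple_vec t).
have JE t : J t = if 0 < q t < 1 then (q t)^-1 else 0.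
  rewrite /J /zero_ext; have [h|/negP h] := boolP (0 < q t < 1).
    by rewrite mem_set//; exact/punctured_ballE.
  by rewrite memNset//; move/punctured_ballE.
have mJ : measurable_fun setT J.
  apply: measurable_zero_ext; first exact: open_punctured_ball.
  move=> x /punctured_ballE /andP[x0 _]; apply: continuous_atV; first by rewrite gt_eqF.
  exact: continuous_sqnorm.
have J0 t : 0 <= J t by rewrite JE; case: ifPn => // /andP[h _]; rewrite invr_ge0 ltW.
pose g (m : nat) t := Num.min m%:R (J t).
have mg m : measurable_fun setT (g m) by apply: measurable_minr.
have g0 m t : 0 <= g m t by rewrite /g le_min J0 ler0n.
have qs t : q (scale_tuple 2 t) = 4 * q t.
  by rewrite /q tuple_vec_scale sqnormZ; congr *%R; ring.
have key m t : g m t <= 4 * \1_B t + 4 * g m (scale_tuple 2 t).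
  have i0 : 0 <= \1_B t :> R by [].
  have s0 := g0 m (scale_tuple 2 t).
  rewrite {1}/g JE; case: ifPn => [/andP[q0 q1]|_]; last first.
    by apply: (@le_trans _ _ 0); [rewrite ge_min lexx orbT|nra].
  have -> : \1_B t = 1 :> R by rewrite indicE mem_set.
  have [q4|q4] := leP 4^-1 (q t).
    have : (q t)^-1 <= 4 by rewrite invf_ple ?posrE.
    by move=> h; rewrite (@le_trans _ _ (q t)^-1)// ?ge_min ?lexx ?orbT//; lra.
  rewrite /g JE qs ifT; last by apply/andP; split; lra.
  have m0 : (0 : R) <= m%:R by [].
  have b0 : 0 < (q t)^-1 by rewrite invr_gt0.
  rewrite (_ : (4 * q t)^-1 = (q t)^-1 / 4); last by field; rewrite gt_eqF.
  set a := m%:R in m0 *; set b := (q t)^-1 in b0 *.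
  by case: (leP a b) => ?; case: (leP a (b / 4)) => ?; lra.
have Ig m : (\int[mu]_t (g m t)%:E <= 8%:E * mu B)%E.
  have fg : (\int[mu]_t (g m t)%:E)%E \is a fin_num.
    rewrite ge0_fin_numE; last by apply: integral_ge0 => t _; rewrite lee_fin.
    apply: (@le_lt_trans _ _ (\int[mu]_t (m%:R%:E * (\1_B t)%:E))%E).
      apply: ge0_le_integral => //.
      - by move=> t _; rewrite lee_fin.
      - exact/measurable_EFinP.
      - by apply: emeasurable_funM => //; exact/measurable_EFinP.
      - move=> t _; rewrite -EFinM lee_fin indicE; have [tB|tB] := boolP (t \in B).
          by rewrite mulr1 ge_min lexx.
        rewrite mulr0 /g JE ifF ?ge_min ?lexx ?orbT//.
        by apply/negP => /andP[_ q1]; move/negP: tB; apply; rewrite inE.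
    rewrite ge0_integralZl//; last exact/measurable_EFinP.
    by rewrite integral_indic// setIT lte_mul_pinfty// lebesgue_tuple_ball.
  have h : (\int[mu]_t (g m t)%:E <=
      4%:E * mu B + 4%:E * ((2 ^- n)%:E * \int[mu]_t (g m t)%:E))%E.
    rewrite -(@ge0_integral_scale _ _ _ (fun t => (g m t)%:E))//; last 2 first.
    - exact/measurable_EFinP.
    - by move=> t; rewrite lee_fin.
    have ms : measurable_fun setT (fun t => (g m (scale_tuple 2 t))%:E).
      apply/measurable_EFinP.
      exact: measurableT_comp (mg m) (measurable_scale_tuple _).
    rewrite -[mu B](_ : (\int[mu]_t (\1_B t)%:E)%E = _); last by rewrite integral_indic// setIT.
    rewrite -!ge0_integralZl//; last 2 first.
    - by move=> t _; rewrite lee_fin.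
    - exact/measurable_EFinP.
    rewrite -ge0_integralD//; last 3 first.
    - by apply: measurable_funeM; exact/measurable_EFinP.
    - by move=> t _; rewrite mule_ge0// lee_fin.
    - exact: measurable_funeM.
    apply: ge0_le_integral => //.
    - by move=> t _; rewrite lee_fin.
    - exact/measurable_EFinP.
    - apply: emeasurable_funD; last exact: measurable_funeM.
      by apply: measurable_funeM; exact/measurable_EFinP.
    - by move=> t _; rewrite -!EFinM -EFinD lee_fin; exact: key.
  move: h; rewrite -(fineK fg) -(fineK vB) -!EFinM -EFinD !lee_fin.
  have a0 : 0 <= fine (\int[mu]_t (g m t)%:E).
    by apply: fine_ge0; apply: integral_ge0 => t _; rewrite lee_fin.
  move: (fine _) (fine _) a0 => a v a0 h.
  have p8 : 2 ^- n <= 8^-1 :> R.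
    rewrite lef_pV2 ?posrE ?exprn_gt0// (_ : 8 = 2 ^+ 3); last by ring.
    by rewrite ler_eXn2l// ltr1n.
  nra.
apply/integrableP; split; first exact/measurable_EFinP.
under eq_integral do rewrite /= ger0_norm//.
apply: (@le_lt_trans _ _ (8%:E * mu B)%E); last first.
  by rewrite lte_mul_pinfty// lebesgue_tuple_ball.
have -> : (\int[mu]_t (J t)%:E = \int[mu]_t limn (fun m => (g m t)%:E))%E.
  apply: eq_integral => t _; apply/esym/cvg_lim => //.
  apply: cvg_near_cst; near=> m; congr EFin; apply/min_idPr.
  rewrite (le_trans (ltW (truncnS_gt _)))// ler_nat.
  by near: m; exact: nbhs_infty_ge.
have nd t : {homo (fun m => (g m t)%:E) : a b / (a <= b)%N >-> (a <= b)%E}.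
  move=> a b ab; rewrite lee_fin /g le_min !ge_min lexx orbT andbT.
  by rewrite ler_nat ab.
rewrite monotone_convergence//; last 2 first.
- by move=> m; exact/measurable_EFinP.
- by move=> m t _; rewrite lee_fin.
apply: lime_le; last by apply: nearW.
apply: ereal_nondecreasing_is_cvgn => a b ab.
apply: ge0_le_integral => //.
- by move=> t _; rewrite lee_fin.
- exact/measurable_EFinP.
- exact/measurable_EFinP.
- by move=> t _; exact: nd.
Unshelve. all: by end_near. Qed.

End measures.

(** * Hyperbolic integrals of compactly supported densities *)

Section hyperbolic_integrals.
Context {R : realType} {N : nat}.
Local Notation mR := (measurableTypeR R).
Local Notation mu := (@lebesgue_tuple R N).
Implicit Types (F G m : 'rV[R]_N -> R) (kap : R -> R).

Lemma zero_ext_out (O : set 'rV[R]_N) G t : ~ O (tuple_vec t) -> zero_ext O G t = 0.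
Proof. by move=> h; rewrite /zero_ext memNset. Qed.

Lemma zero_ext_in (O : set 'rV[R]_N) G t : O (tuple_vec t) ->
  zero_ext O G t = G (tuple_vec t).
Proof. by move=> h; rewrite /zero_ext mem_set. Qed.

(** Hyperbolic integrals only see their density off the centre, where it is
    given by a formula G that is continuous but possibly singular at 0. *)
Lemma hyp_integralE F G : (0 < N)%N ->
  (forall x, punctured_ball x -> {for x, continuous G}) ->
  (forall x, punctured_ball x -> F x * conformal_factor x ^+ N = G x) ->
  hyp_integral F = (\int[mu]_t (zero_ext punctured_ball G t)%:E)%E.
Proof.
move=> N0 cG FG; rewrite /hyp_integral /metric_integral.
set U := (X in (\int[_]_(t in X) _)%E); rewrite -/(@tuple_vec R N).
have mU : measurable U by exact: measurable_preimage_open open_poincare_ball.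
have mG : measurable_fun setT (zero_ext punctured_ball G).
  exact: measurable_zero_ext open_punctured_ball cG.
pose f (t : N.-tuple mR) :=
  F (tuple_vec t) * Num.sqrt (\det (poincare_metric (tuple_vec t))).
have fE t : U t -> tuple_vec t != 0 -> f t = zero_ext punctured_ball G t.
  by move=> Ut t0; rewrite /f zero_ext_in ?poincare_density ?FG.
pose Z := @tuple_vec R N @^-1` [set 0].
have mZ : measurable Z := measurable_origin.
have mf : measurable_fun U f.
  rewrite -(setUIDK U Z); apply/measurable_funU; [exact: measurableI|exact: measurableD|split].
    have [[t0 Zt0]|nZ] := pselect (exists t, Z t).
      have Z1 : [set t0] = Z.
        by apply/seteqP; split => [t ->//|t Zt]; apply: tuple_vec_inj; rewrite Zt0 Zt.
      apply: (@measurable_funS _ _ _ _ [set t0]); last exact: measurable_fun_set1.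
        by rewrite Z1.
      by move=> t [_ Zt]; rewrite Z1.
    rewrite (_ : U `&` Z = set0); first exact: measurable_fun_set0.
    by apply/seteqP; split => // t [_ Zt]; apply: nZ; exists t.
  apply: (@eq_measurable_fun _ _ _ _ _ (zero_ext punctured_ball G)).
    by move=> t; rewrite inE => -[Ut Zt]; rewrite fE//; exact/eqP.
  exact: measurable_funS mG.
transitivity (\int[mu]_(t in U) (zero_ext punctured_ball G t)%:E)%E.
  apply: ae_eq_integral => //.
  - exact/measurable_EFinP.
  - by apply/measurable_EFinP; exact: measurable_funS mG.
  - exists Z; split => //; first exact: lebesgue_tuple_origin.
    move=> t /= h; apply: contrapT => /eqP Zt; apply: h => Ut.
    by congr EFin; exact: fE.
rewrite integral_mkcond; apply: eq_integral => t _.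
rewrite patchE; case: ifPn => //; rewrite notin_setE => Ut.
by rewrite zero_ext_out// => -[].
Qed.

Lemma continuous_euclid_norm : continuous (@euclid_norm R N).
Proof.
move=> x; apply: (@continuous_comp _ _ _ (@sqnorm R N) Num.sqrt).
  exact: continuous_sqnorm.
exact: sqrt_continuous.
Qed.

Lemma punctured_ball_norm (x : 'rV[R]_N) : punctured_ball x -> 0 < euclid_norm x < 1.
Proof.
move=> [Ux x0]; rewrite euclid_norm_gt0//.
by have /andP[] := euclid_norm_itv Ux.
Qed.

Lemma continuous_kernel m kap x : punctured_ball x -> {for x, continuous m} ->
  (forall r, 0 < r < 1 -> {for r, continuous kap}) ->
  {for x, continuous (fun y => m y * kap (euclid_norm y))}.
Proof.
move=> Px cm ck; apply: continuous_atM => //.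
apply: (@continuous_comp _ _ _ (@euclid_norm R N) kap).
  exact: continuous_euclid_norm.
exact/ck/punctured_ball_norm.
Qed.

Lemma bounded_on_ball m (K : set 'rV[R]_N) : compact K -> K `<=` poincare_ball ->
  (forall x, poincare_ball x -> {for x, continuous m}) ->
  (forall x, poincare_ball x -> ~ K x -> m x = 0) ->
  exists2 M, 0 <= M & forall x, poincare_ball x -> `|m x| <= M.
Proof.
move=> cK KU cm m0; have [K0|/set0P nK] := eqVneq K set0.
  by exists 0 => // x Ux; rewrite m0 ?normr0// K0.
have cn : {within K, continuous (fun x => `|m x|)}.
  apply: continuous_in_subspaceT => x; rewrite inE => Kx.
  apply: (@continuous_comp _ _ _ m Num.norm); last exact: norm_continuous.
  exact/cm/KU.
have [c cK' cmax] := EVT_max_rV nK cK cn.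
exists `|m c| => // x Ux; have [Kx|nKx] := pselect (K x).
  by apply: cmax; rewrite inE.
by rewrite m0// normr0.
Qed.

(** All integrands below are a continuous compactly supported factor m times a
    kernel of the norm that is no more singular than 1 / r^2. *)
Lemma integrable_kernel m kap (K : set 'rV[R]_N) C : (3 <= N)%N ->
  compact K -> K `<=` poincare_ball ->
  (forall x, poincare_ball x -> {for x, continuous m}) ->
  (forall x, poincare_ball x -> ~ K x -> m x = 0) ->
  (forall r, 0 < r < 1 -> {for r, continuous kap}) ->
  (forall r, 0 < r < 1 -> `|kap r| * r ^+ 2 <= C) ->
  mu.-integrable setT
    (EFin \o zero_ext punctured_ball (fun x => m x * kap (euclid_norm x))).
Proof.
move=> N3 cK KU cm m0 ck kC.
have [M M0 mM] := bounded_on_ball cK KU cm m0.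
have iJ := @integrable_inv_sqnorm R N N3.
have := integrableZl measurableT (M * C) iJ.
apply: le_integrable => //.
  apply/measurable_EFinP; apply: measurable_zero_ext open_punctured_ball _.
  by move=> x Px; apply: continuous_kernel => //; apply: cm; case: Px.
move=> t _ /=; rewrite lee_fin.
have [Pt|Pt] := pselect (punctured_ball (tuple_vec t)); last first.
  by rewrite !zero_ext_out// mulr0.
rewrite !zero_ext_in// -sqr_euclid_norm normrM.
have r01 := punctured_ball_norm Pt; have kr := kC _ r01.
have /andP[r0 _] := r01; have Ut : poincare_ball (tuple_vec t) by case: Pt.
have C0 : 0 <= C by apply: le_trans kr; rewrite mulr_ge0// exprn_ge0// ltW.
rewrite [leRHS]ger0_norm; last by rewrite mulr_ge0 ?mulr_ge0// invr_ge0 exprn_ge0// ltW.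
rewrite -mulrA ler_pM// ?mM//.
by rewrite ler_pdivlMr// exprn_gt0.
Qed.

End hyperbolic_integrals.

(** * Densities of a test function and radial kernels *)

Section test_functions.
Context {R : realType} {N : nat}.
Variables (f : 'rV[R]_N -> R) (K : set 'rV[R]_N).
Hypothesis sf : smooth_on poincare_ball f.
Hypothesis cK : compact K.
Hypothesis KU : K `<=` poincare_ball.
Hypothesis fK : forall x, poincare_ball x -> ~ K x -> f x = 0.
Local Notation mR := (measurableTypeR R).
Local Notation mu := (@lebesgue_tuple R N).
Implicit Types x y : 'rV[R]_N.

(** The derivative of f along the radial field, r times its Euclidean radial
    derivative. *)
Definition euler x : R := \sum_i x 0 i * partial i f x.

Lemma test_differentiable x : poincare_ball x -> differentiable f x.
Proof. by move=> Ux; exact: (sf [::] Ux). Qed.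

Lemma test_continuous x : poincare_ball x -> {for x, continuous f}.
Proof. by move=> Ux; exact/differentiable_continuous/test_differentiable. Qed.

Lemma partial_continuous i x : poincare_ball x -> {for x, continuous (partial i f)}.
Proof. by move=> Ux; apply: differentiable_continuous; exact: (sf [:: i] Ux). Qed.

Lemma near_off_support x : ~ K x -> \forall y \near x, ~ K y.
Proof.
move=> nK; have : open (~` K).
  by apply: closed_openC; apply: compact_closed => //; exact: norm_hausdorff.
by rewrite openE; apply.
Qed.

Lemma partial_off_support i x : poincare_ball x -> ~ K x -> partial i f x = 0.
Proof.
move=> Ux nK; rewrite /partial (@near_eq_derive _ _ _ f (cst 0)) ?derive_cst//.
near=> y; apply: fK.
  by near: y; have := @open_poincare_ball R N; rewrite openE; apply.
by near: y; exact: near_off_support.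
Unshelve. all: by end_near. Qed.

Lemma euler_continuous x : poincare_ball x -> {for x, continuous euler}.
Proof.
move=> Ux; apply: continuous_at_sum => i; apply: continuous_atM.
  exact: coord_continuous.
exact: partial_continuous.
Qed.

Lemma euler_off_support x : poincare_ball x -> ~ K x -> euler x = 0.
Proof.
by move=> Ux nK; rewrite /euler big1// => i _; rewrite partial_off_support// mulr0.
Qed.

(** The quadratic expressions in f and its first derivatives that occur in the
    integrands, multiplied by the volume density and freed from their powers of
    rho and r, so that they are continuous on the whole ball. *)
Definition sq_density x : R := f x ^+ 2 * conformal_factor x ^+ N.
Definition grad_density x : R :=
  (\sum_i partial i f x ^+ 2) * (conformal_factor x ^+ N / conformal_factor x ^+ 2).
Definition euler_density x : R :=
  euler x ^+ 2 * (conformal_factor x ^+ N / conformal_factor x ^+ 2).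
Definition mixed_density x : R :=
  f x * euler x * (conformal_factor x ^+ N / conformal_factor x).

Lemma conformal_ratio_continuous n m x : poincare_ball x ->
  {for x, continuous (fun y => conformal_factor y ^+ n / conformal_factor y ^+ m)}.
Proof.
move=> Ux; have cc := continuous_conformal_factor Ux.
apply: continuous_atM; first exact: continuous_atX.
apply: continuous_atV; last exact: continuous_atX.
by rewrite expf_neq0// gt_eqF// conformal_factor_gt0.
Qed.

Lemma sq_density_continuous x : poincare_ball x -> {for x, continuous sq_density}.
Proof.
move=> Ux; apply: continuous_atM; apply: continuous_atX.
  exact: test_continuous.
exact: continuous_conformal_factor.
Qed.

Lemma grad_density_continuous x : poincare_ball x -> {for x, continuous grad_density}.
Proof.
move=> Ux; apply: continuous_atM; last exact: conformal_ratio_continuous.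
by apply: continuous_at_sum => i; apply: continuous_atX; exact: partial_continuous.
Qed.

Lemma euler_density_continuous x : poincare_ball x -> {for x, continuous euler_density}.
Proof.
move=> Ux; apply: continuous_atM; last exact: conformal_ratio_continuous.
by apply: continuous_atX; exact: euler_continuous.
Qed.

Lemma mixed_density_continuous x : poincare_ball x -> {for x, continuous mixed_density}.
Proof.
move=> Ux; apply: continuous_atM; last exact: (@conformal_ratio_continuous N 1).
by apply: continuous_atM; [exact: test_continuous|exact: euler_continuous].
Qed.

Lemma sq_density_off x : poincare_ball x -> ~ K x -> sq_density x = 0.
Proof. by move=> Ux nK; rewrite /sq_density fK// expr0n mul0r. Qed.

Lemma grad_density_off x : poincare_ball x -> ~ K x -> grad_density x = 0.
Proof.
move=> Ux nK; rewrite /grad_density big1 ?mul0r// => i _.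
by rewrite partial_off_support// expr0n.
Qed.

Lemma euler_density_off x : poincare_ball x -> ~ K x -> euler_density x = 0.
Proof. by move=> Ux nK; rewrite /euler_density euler_off_support// expr0n mul0r. Qed.

Lemma mixed_density_off x : poincare_ball x -> ~ K x -> mixed_density x = 0.
Proof. by move=> Ux nK; rewrite /mixed_density euler_off_support// mulr0 mul0r. Qed.

End test_functions.

Section kernels.
Context {R : realType}.
Implicit Types r : R.

Definition ker_rho r : R := (r * hyp_radius r)^-1.
Definition ker_rho2 r : R := (hyp_radius r ^+ 2)^-1.
(** In terms of rho this is a coth rho / rho - 1 / rho^2. It is the curvature
    kernel for a = 1, and the divergence of (grad rho) / rho for a = N - 1. *)
Definition ker_curv (a : R) r : R := a * (1 + r ^+ 2) / 2 * ker_rho r - ker_rho2 r.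

Lemma hyp_radius_gt0 r : 0 < r < 1 -> 0 < hyp_radius r.
Proof.
move=> /andP[r0 r1]; apply: (@lt_le_trans _ _ (2 * r)); first lra.
by apply: hyp_radius_ge; apply/andP; split; lra.
Qed.

Let itv r : 0 < r < 1 -> -1 < r < 1.
Proof. by move=> /andP[r0 r1]; apply/andP; split; lra. Qed.

Lemma ker_rho_continuous r : 0 < r < 1 -> {for r, continuous ker_rho}.
Proof.
move=> r01; have L0 := hyp_radius_gt0 r01; have /andP[r0 _] := r01.
apply: continuous_atV; first by rewrite mulf_neq0// gt_eqF.
apply: continuous_atM; last exact/continuous_hyp_radius/itv.
exact: cvg_id.
Qed.

Lemma ker_rho2_continuous r : 0 < r < 1 -> {for r, continuous ker_rho2}.
Proof.
move=> r01; have L0 := hyp_radius_gt0 r01.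
apply: continuous_atV; first by rewrite expf_neq0// gt_eqF.
by apply: continuous_atX; exact/continuous_hyp_radius/itv.
Qed.

Lemma ker_curv_continuous a r : 0 < r < 1 -> {for r, continuous (ker_curv a)}.
Proof.
move=> r01; apply: continuous_atB; last exact: ker_rho2_continuous.
apply: continuous_atM; last exact: ker_rho_continuous.
apply: continuous_atM; last exact: continuous_at_cst.
apply: continuous_atM; first exact: continuous_at_cst.
apply: continuous_atD; first exact: continuous_at_cst.
by apply: continuous_atX; exact: cvg_id.
Qed.

Lemma ker_rho_bound r : 0 < r < 1 -> 0 <= ker_rho r * r ^+ 2 <= 2^-1.
Proof.
move=> r01; have L0 := hyp_radius_gt0 r01; have /andP[r0 r1] := r01.
have Lr : 2 * r <= hyp_radius r by apply: hyp_radius_ge; apply/andP; split; lra.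
rewrite /ker_rho (_ : _ * _ = r / hyp_radius r); last by field; rewrite !gt_eqF.
apply/andP; split; first by rewrite divr_ge0// ltW.
by rewrite ler_pdivrMr//; lra.
Qed.

Lemma ker_rho2_bound r : 0 < r < 1 -> 0 <= ker_rho2 r * r ^+ 2 <= 4^-1.
Proof.
move=> r01; have L0 := hyp_radius_gt0 r01; have /andP[r0 r1] := r01.
have Lr : 2 * r <= hyp_radius r by apply: hyp_radius_ge; apply/andP; split; lra.
have L2 : 0 < hyp_radius r ^+ 2 by rewrite exprn_gt0.
rewrite (_ : _ * _ = r ^+ 2 / hyp_radius r ^+ 2); last by rewrite mulrC.
apply/andP; split; first by rewrite divr_ge0// ltW// exprn_gt0.
by rewrite ler_pdivrMr//; nra.
Qed.

Lemma ker_curv_bound a r : 0 <= a -> 0 < r < 1 -> `|ker_curv a r| * r ^+ 2 <= a + 1.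
Proof.
move=> a0 r01; have /andP[r0 r1] := r01.
have /andP[h1 h2] := ker_rho_bound r01; have /andP[h3 h4] := ker_rho2_bound r01.
have r2 : 0 <= r ^+ 2 by exact: sqr_ge0.
rewrite -[X in _ * X]ger0_norm// -normrM /ker_curv.
set u := ker_rho r * r ^+ 2 in h1 h2; set v := ker_rho2 r * r ^+ 2 in h3 h4.
rewrite (_ : _ * _ = a * (1 + r ^+ 2) / 2 * u - v); last by rewrite /u /v; ring.
rewrite ler_norml.
have r21 : r ^+ 2 <= 1 by nra.
have : 0 <= a * (1 + r ^+ 2) / 2 * u by rewrite mulr_ge0// divr_ge0// mulr_ge0// addr_ge0.
have : a * (1 + r ^+ 2) / 2 * u <= a.
  apply: (@le_trans _ _ (a * u)); last by nra.
  by rewrite ler_wpM2r//; nra.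
by move=> ? ?; apply/andP; split; lra.
Qed.

End kernels.

(** * The radial flux and its divergence *)

Section dilation_identity.
Context {R : realType} {N : nat}.
Variables (f : 'rV[R]_N -> R) (K : set 'rV[R]_N).
Hypothesis sf : smooth_on poincare_ball f.
Hypothesis cK : compact K.
Hypothesis KU : K `<=` poincare_ball.
Hypothesis fK : forall x, poincare_ball x -> ~ K x -> f x = 0.
Hypothesis N3 : (3 <= N)%N.
Local Notation mR := (measurableTypeR R).
Local Notation mu := (@lebesgue_tuple R N).
Implicit Types x y : 'rV[R]_N.

(** The field f^2 (grad rho) / rho multiplied by the volume density is the vector
    [flux x] x. *)
Definition flux x : R :=
  f x ^+ 2 * (conformal_factor x ^+ N / conformal_factor x) * ker_rho (euclid_norm x).

(** The divergence of the vector field with value [flux x] x at x. *)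
Definition flux_div x : R :=
  2 * (mixed_density f x * ker_rho (euclid_norm x)) +
  sq_density f x * ker_curv (N%:R - 1) (euclid_norm x).

Lemma is_derive_flux x (s : R) : punctured_ball (expR s *: x) ->
  is_derive s 1 (fun u : R => expR u ^+ N * flux (expR u *: x))
    (expR s ^+ N * flux_div (expR s *: x)).
Proof.
move=> Py; have [Uy y0] := Py.
have ny u : euclid_norm (expR u *: x) = expR u * euclid_norm x.
  by rewrite euclid_normZ ger0_norm// expR_ge0.
have := punctured_ball_norm Py; rewrite ny; set r0 := euclid_norm x => r01.
have /andP[rp r1] := r01; have L0 := hyp_radius_gt0 r01.
have r11 : -1 < expR s * r0 < 1 by apply/andP; split; lra.
have dy := is_derive_dilation x s.
have dF := is_derive_comp_curve (test_differentiable sf Uy) dy.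
have dc := is_derive_conformal_factor Uy dy.
have c0 : conformal_factor (expR s *: x) != 0 by rewrite gt_eqF// conformal_factor_gt0.
have dcN := @is_derive_pow R (fun u => conformal_factor (expR u *: x)) N _ _ c0 dc.
have e0 : expR s != 0 by rewrite gt_eqF// expR_gt0.
have dEN := @is_derive_pow R expR N _ _ e0 (is_derive_expR s).
have dr : is_derive s 1 (fun u => expR u * r0) (expR s * r0).
  by apply: is_derive_eq; rewrite /GRing.scale/=; ring.
have dL := @is_derive1_comp R hyp_radius (fun u => expR u * r0) s _ _
  (is_derive_hyp_radius r11) dr.
have dnum := is_derive_mul dEN (is_derive_mul (is_derive_mul dF dF) dcN).
have dden := is_derive_mul dc (is_derive_mul dr dL).
pose num u := expR u ^+ N * (f (expR u *: x) * f (expR u *: x) *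
  conformal_factor (expR u *: x) ^+ N).
pose den u := conformal_factor (expR u *: x) * (expR u * r0 * hyp_radius (expR u * r0)).
have den0 : den s != 0.
  by apply: mulf_neq0 => //; apply: mulf_neq0; rewrite gt_eqF.
have := @is_derive_div _ num den _ _ _ den0 dnum dden.
rewrite (_ : (fun u => expR u ^+ N * flux (expR u *: x)) = (fun u => num u / den u)); last first.
  by apply/funext => u; rewrite /flux /ker_rho /num /den ny -/r0 /= !invfM; ring.
move/is_derive_eq; apply.
rewrite /num /den /flux_div /mixed_density /sq_density /ker_curv /ker_rho /ker_rho2 ny -/r0 /=.
rewrite -/(euler f (expR s *: x)).
rewrite (_ : \sum_i _ = sqnorm (expR s *: x)); last first.
  by apply: eq_bigr => i _; rewrite expr2.
have cE : conformal_factor (expR s *: x) = 2 / (1 - (expR s * r0) ^+ 2).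
  by rewrite /conformal_factor -sqr_euclid_norm ny.
rewrite -sqr_euclid_norm ny -/r0.
move: (conformal_factor _ ^+ N) (expR s ^+ N) => CN EN.
rewrite cE; move: (euler _ _) (f _) => Eu F.
move: rp r1 L0 e0 => rp r1 L0 e0.
have r00 : r0 != 0 by apply: contraTneq rp => ->; rewrite mulr0 ltxx.
have d0 : 1 - (expR s * r0) ^+ 2 != 0 by rewrite gt_eqF//; nra.
move: (hyp_radius _) L0 => L L0.
move: (expR s) e0 rp r1 r00 d0 => e e0 rp r1 r00 d0.
field; rewrite r00 e0 d0 gt_eqF//=.
Qed.

Lemma flux_div_continuous x : punctured_ball x -> {for x, continuous flux_div}.
Proof.
move=> Px; have [Ux _] := Px; apply: continuous_atD.
  apply: continuous_atM; first exact: continuous_at_cst.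
  apply: continuous_kernel => //; first exact: mixed_density_continuous.
  exact: ker_rho_continuous.
apply: continuous_kernel => //; first exact: sq_density_continuous.
by move=> r; exact: ker_curv_continuous.
Qed.

Lemma integrable_dens01 : mu.-integrable setT (EFin \o zero_ext punctured_ball
  (fun x => mixed_density f x * ker_rho (euclid_norm x))).
Proof.
apply: (@integrable_kernel _ _ _ _ K 2^-1) => //.
- exact: mixed_density_continuous.
- exact: mixed_density_off.
- exact: ker_rho_continuous.
- move=> r r01; have /andP[h1 h2] := ker_rho_bound r01.
  by rewrite -[X in _ * X]ger0_norm ?sqr_ge0// -normrM ger0_norm.
Qed.

Lemma integrable_dens00 a : 0 <= a -> mu.-integrable setT (EFin \o zero_ext punctured_ball
  (fun x => sq_density f x * ker_curv a (euclid_norm x))).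
Proof.
move=> a0; apply: (@integrable_kernel _ _ _ _ K (a + 1)) => //.
- exact: sq_density_continuous.
- exact: sq_density_off.
- by move=> r; exact: ker_curv_continuous.
- by move=> r; exact: ker_curv_bound.
Qed.

Lemma integrable_flux_div : mu.-integrable setT (EFin \o zero_ext punctured_ball flux_div).
Proof.
have a0 : 0 <= N%:R - 1 :> R by rewrite subr_ge0 ler1n (leq_trans _ N3).
have i1 := integrableZl measurableT 2 integrable_dens01.
have := integrableD measurableT i1 (integrable_dens00 a0).
apply: eq_integrable => // t _ /=.
rewrite -EFinM -EFinD; congr EFin.
by rewrite /zero_ext; case: ifPn => // _; rewrite mulr0 addr0.
Qed.

Lemma integrable_flux : mu.-integrable setT (EFin \o zero_ext punctured_ball flux).
Proof.
apply: (@integrable_kernel _ _ _ _ K 2^-1) => //.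
- move=> x Ux; apply: continuous_atM; last exact: (@conformal_ratio_continuous _ _ N 1).
  by apply: continuous_atX; exact: test_continuous.
- by move=> x Ux nK; rewrite fK// expr0n mul0r.
- exact: ker_rho_continuous.
- move=> r r01; have /andP[h1 h2] := ker_rho_bound r01.
  by rewrite -[X in _ * X]ger0_norm ?sqr_ge0// -normrM ger0_norm.
Qed.

Lemma flux_off x : ~ K x -> punctured_ball x -> flux x = 0.
Proof. by move=> nK [Ux _]; rewrite /flux fK// expr0n !mul0r. Qed.

Lemma flux_div_off x : ~ K x -> punctured_ball x -> flux_div x = 0.
Proof.
move=> nK [Ux _]; rewrite /flux_div (mixed_density_off cK fK)// (sq_density_off fK)//.
by rewrite !mul0r mulr0 addr0.
Qed.

(** Along a dilation orbit a function vanishing off K is either given by its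
    formula or locally zero: where the orbit leaves the ball it has already left
    the compact set K. *)
Lemma near_dilation_zero_ext (g : 'rV[R]_N -> R) (t : N.-tuple mR) (s : R) :
  (forall x, ~ K x -> punctured_ball x -> g x = 0) ->
  punctured_ball (expR s *: tuple_vec t) /\
    (\forall u \near s, expR u ^+ N * g (expR u *: tuple_vec t) =
      expR u ^+ N * zero_ext punctured_ball g (scale_tuple (expR u) t)) \/
  ~ punctured_ball (expR s *: tuple_vec t) /\
    (\forall u \near s, 0 = expR u ^+ N * zero_ext punctured_ball g (scale_tuple (expR u) t)).
Proof.
move=> g0.
have cdil : {for s, continuous (fun u : R => expR u *: tuple_vec t)}.
  apply: continuous_curve; have dd := is_derive_dilation (tuple_vec t) s.
  exact: (@ex_derive _ _ _ _ _ _ _ dd).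
have [Py|nPy] := pselect (punctured_ball (expR s *: tuple_vec t)); [left|right]; split => //.
  have : \forall u \near s, punctured_ball (expR u *: tuple_vec t).
    exact: (near_open_curve cdil open_punctured_ball Py).
  by apply: (@filterS _ (nbhs s)) => u Pu; rewrite zero_ext_in tuple_vec_scale.
have [t0|t0] := eqVneq (tuple_vec t) 0.
  apply: (@filterE _ (nbhs s)) => u; rewrite zero_ext_out ?mulr0// tuple_vec_scale t0 scaler0.
  by case; rewrite eqxx.
have nK : ~ K (expR s *: tuple_vec t).
  move=> Ky; apply: nPy; split; first exact: KU.
  by rewrite scaler_eq0 negb_or t0 gt_eqF// expR_gt0.
have oK : open (~` K).
  by apply: closed_openC; apply: compact_closed => //; exact: norm_hausdorff.
have : \forall u \near s, ~ K (expR u *: tuple_vec t).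
  exact: (near_open_curve cdil oK nK).
apply: (@filterS _ (nbhs s)) => u nKu.
have [Pu|nPu] := pselect (punctured_ball (expR u *: tuple_vec t)).
  by rewrite zero_ext_in tuple_vec_scale// g0// mulr0.
by rewrite zero_ext_out ?mulr0// tuple_vec_scale.
Qed.

Lemma integral_flux_div : (\int[mu]_t (zero_ext punctured_ball flux_div t)%:E = 0)%E.
Proof.
apply: (integral_dilation_derivative integrable_flux integrable_flux_div) => t s.
- have [[Py nE]|[nPy nE]] := near_dilation_zero_ext t s flux_off.
    rewrite [zero_ext _ flux_div _]zero_ext_in tuple_vec_scale//.
    exact: near_eq_is_derive nE (is_derive_flux Py).
  rewrite [zero_ext _ flux_div _]zero_ext_out ?tuple_vec_scale// mulr0.
  exact: near_eq_is_derive nE (is_derive_cst _ _ _).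
- have cdil : {for s, continuous (fun u : R => expR u *: tuple_vec t)}.
    apply: continuous_curve; have dd := is_derive_dilation (tuple_vec t) s.
    exact: (@ex_derive _ _ _ _ _ _ _ dd).
  have [[Py nE]|[nPy nE]] := near_dilation_zero_ext t s flux_div_off; last first.
    by apply: (near_eq_continuous nE); exact: continuous_at_cst.
  apply: (near_eq_continuous nE).
  apply: continuous_atM.
    by apply: continuous_atX; exact: continuous_expR.
  apply: (@continuous_comp _ _ _ (fun u : R => expR u *: tuple_vec t) flux_div) => //.
  exact: flux_div_continuous.
Qed.

End dilation_identity.

(** * The weighted function and the Hardy identities *)

Section weighted_function.
Context {R : realType} {N : nat}.
Variables (f : 'rV[R]_N -> R) (b : R).
Implicit Types x v : 'rV[R]_N.

Definition weighted x : R := hyp_rho x `^ (b / 2) * f x.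

Lemma powR_half_sqr (r : R) : 0 < r -> r `^ b = (r `^ (b / 2)) ^+ 2.
Proof.
move=> r0; rewrite expr2 -powRD; last by rewrite (gt_eqF r0) implybT.
by congr powR; field.
Qed.

Lemma hyp_rho_near (c : R -> 'rV[R]_N) (t : R) :
  punctured_ball (c t) -> {for t, continuous c} ->
  \forall s \near t, hyp_radius (euclid_norm (c s)) = hyp_rho (c s).
Proof.
move=> Pt cc; have := near_open_curve cc open_punctured_ball Pt.
by apply: (@filterS _ (nbhs t)) => s [Us s0]; rewrite hyp_rhoE.
Qed.

Lemma is_derive_hyp_rho (c : R -> 'rV[R]_N) v (t : R) :
  punctured_ball (c t) -> is_derive t 1 c v ->
  is_derive t 1 (fun s => hyp_rho (c s))
    (conformal_factor (c t) * (\sum_i c t 0 i * v 0 i) / euclid_norm (c t)).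
Proof.
move=> Pt dc; have cc : {for t, continuous c}.
  by apply: continuous_curve; exact: (@ex_derive _ _ _ _ _ _ _ dc).
have [Ut t0] := Pt; have /andP[r0 r1] := punctured_ball_norm Pt.
have q0 : 0 < sqnorm (c t) by rewrite sqnorm_gt0.
have dn := is_derive_sqrt_comp q0 (is_derive_sqnorm dc).
have dL := @is_derive1_comp R hyp_radius (fun s => euclid_norm (c s)) t _ _
  (is_derive_hyp_radius (euclid_norm_itv Ut)) dn.
apply: (near_eq_is_derive (hyp_rho_near Pt cc)).
apply: (is_derive_eq dL); rewrite sqr_euclid_norm -/(euclid_norm (c t)) /conformal_factor.
field; rewrite !gt_eqF// subr_gt0.
exact: Ut.
Qed.

(** Both the partial derivatives and the radial derivative of the weighted
    function are instances, with c a coordinate line or a geodesic ray. *)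
Lemma is_derive_weighted (c : R -> 'rV[R]_N) v (t : R) :
  punctured_ball (c t) -> differentiable f (c t) -> is_derive t 1 c v ->
  is_derive t 1 (fun s => weighted (c s))
    (hyp_rho (c t) `^ (b / 2) * (\sum_i v 0 i * partial i f (c t) +
      b / 2 * conformal_factor (c t) / (hyp_rho (c t) * euclid_norm (c t)) * f (c t) *
        \sum_i c t 0 i * v 0 i)).
Proof.
move=> Pt df dc; have [Ut t0] := Pt.
have rho0 := hyp_rho_gt0 Ut t0; have /andP[r0 _] := punctured_ball_norm Pt.
have dr := is_derive_hyp_rho Pt dc.
have dp := @is_derive1_comp R (fun u : R => u `^ (b / 2)) (fun s => hyp_rho (c s)) t _ _
  (is_derive1_powR _ rho0) dr.
have := is_derive_mul dp (is_derive_comp_curve df dc).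
move/is_derive_eq; apply => /=.
rewrite powRB; last by rewrite (gt_eqF rho0) implybT.
rewrite powRr1; last exact: ltW.
by field; rewrite !gt_eqF.
Qed.

Lemma partial_weighted i x : punctured_ball x -> differentiable f x ->
  partial i weighted x = hyp_rho x `^ (b / 2) * (partial i f x +
    b / 2 * conformal_factor x / (hyp_rho x * euclid_norm x) * f x * x 0 i).
Proof.
move=> Px df; rewrite /partial.
have := @is_derive_weighted (fun t : R => t *: delta_mx 0 i + x) (delta_mx 0 i) 0.
rewrite /= scale0r add0r => /(_ Px df (is_derive_line_id _ _)) dh.
rewrite (@derive_val _ _ _ _ _ _ _ (is_derive_line dh)) sum_delta.
by under eq_bigr do rewrite mulrC; rewrite sum_delta.
Qed.

Lemma hyp_radial_weighted x : punctured_ball x -> differentiable f x ->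
  hyp_radial weighted x = hyp_rho x `^ (b / 2) *
    (euler f x / (conformal_factor x * euclid_norm x) + b / 2 / hyp_rho x * f x).
Proof.
move=> Px df; have [Ux x0] := Px; have /andP[r0 r1] := punctured_ball_norm Px.
have rho0 := hyp_rho_gt0 Ux x0; have c0 := conformal_factor_gt0 Ux.
have th : tanh_half (hyp_rho x) = euclid_norm x.
  by rewrite hyp_rhoE// tanh_half_hyp_radius// euclid_norm_itv.
have xE : (tanh_half (hyp_rho x) / euclid_norm x) *: x = x.
  by rewrite th divff ?scale1r// gt_eqF.
apply: is_derive_hyp_radial => //.
have := @is_derive_weighted (fun t : R => (tanh_half t / euclid_norm x) *: x) _
  (hyp_rho x) _ _ (is_derive_ray x (hyp_rho x)).
rewrite xE => /(_ Px df) /is_derive_eq; apply; congr *%R.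
have cE : conformal_factor x = 2 / (1 - euclid_norm x ^+ 2) by rewrite sqr_euclid_norm.
have d0 : 1 - euclid_norm x ^+ 2 != 0 by rewrite gt_eqF// sqr_euclid_norm subr_gt0; exact: Ux.
have s1 k : \sum_i (k *: x) 0 i * partial i f x = k * euler f x.
  by rewrite /euler mulr_sumr; apply: eq_bigr => i _; rewrite mxE mulrA.
have s2 k : \sum_i x 0 i * (k *: x) 0 i = k * euclid_norm x ^+ 2.
  by rewrite sqr_euclid_norm mulr_sumr; apply: eq_bigr => i _; rewrite mxE; ring.
rewrite th s1 s2 cE.
by field; rewrite d0 !gt_eqF.
Qed.

Lemma weighted_gradient_density x : punctured_ball x -> differentiable f x ->
  1 / hyp_rho x `^ b * hyp_grad_norm weighted x ^+ 2 * conformal_factor x ^+ N =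
  grad_density f x + b * (mixed_density f x * ker_rho (euclid_norm x)) +
    (b / 2) ^+ 2 * (sq_density f x * ker_rho2 (euclid_norm x)).
Proof.
move=> Px df; have [Ux x0] := Px; have /andP[r0 r1] := punctured_ball_norm Px.
have rho0 := hyp_rho_gt0 Ux x0; have c0 := conformal_factor_gt0 Ux.
rewrite sqr_hyp_grad_norm// (powR_half_sqr rho0).
have q0 : 0 < hyp_rho x `^ (b / 2) by exact: powR_gt0.
set q := hyp_rho x `^ (b / 2) in q0 *.
set e := b / 2 * conformal_factor x / (hyp_rho x * euclid_norm x) * f x.
have -> : \sum_i partial i weighted x ^+ 2 = q ^+ 2 * (\sum_i partial i f x ^+ 2 +
    2 * e * euler f x + e ^+ 2 * euclid_norm x ^+ 2).
  rewrite sqr_euclid_norm /euler /sqnorm 2!mulr_sumr -!big_split/= mulr_sumr.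
  by apply: eq_bigr => i _; rewrite partial_weighted// -/q -/e; ring.
rewrite /grad_density /mixed_density /sq_density /ker_rho /ker_rho2 -hyp_rhoE// /e.
move: (\sum_i _) (conformal_factor x ^+ N) => S CN.
by field; rewrite !gt_eqF.
Qed.

Lemma weighted_radial_density x : punctured_ball x -> differentiable f x ->
  1 / hyp_rho x `^ b * `|hyp_radial weighted x| ^+ 2 * conformal_factor x ^+ N =
  euler_density f x * (euclid_norm x ^+ 2)^-1 + b * (mixed_density f x * ker_rho (euclid_norm x)) +
    (b / 2) ^+ 2 * (sq_density f x * ker_rho2 (euclid_norm x)).
Proof.
move=> Px df; have [Ux x0] := Px; have /andP[r0 r1] := punctured_ball_norm Px.
have rho0 := hyp_rho_gt0 Ux x0; have c0 := conformal_factor_gt0 Ux.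
rewrite real_normK ?num_real// hyp_radial_weighted// (powR_half_sqr rho0).
have q0 : 0 < hyp_rho x `^ (b / 2) by exact: powR_gt0.
set q := hyp_rho x `^ (b / 2) in q0 *.
rewrite /euler_density /mixed_density /sq_density /ker_rho /ker_rho2 -hyp_rhoE//.
move: (conformal_factor x ^+ N) => CN.
by field; rewrite !gt_eqF.
Qed.

Lemma hyp_grad_norm_density x : poincare_ball x ->
  hyp_grad_norm f x ^+ 2 * conformal_factor x ^+ N = grad_density f x.
Proof.
move=> Ux; have c0 := conformal_factor_gt0 Ux.
by rewrite sqr_hyp_grad_norm// /grad_density; ring.
Qed.

Lemma hyp_radial_density x : punctured_ball x -> differentiable f x ->
  `|hyp_radial f x| ^+ 2 * conformal_factor x ^+ N =
  euler_density f x * (euclid_norm x ^+ 2)^-1.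
Proof.
move=> Px df; have [Ux x0] := Px; have /andP[r0 r1] := punctured_ball_norm Px.
have c0 := conformal_factor_gt0 Ux.
rewrite real_normK ?num_real// hyp_radialE// -/(euler f x) /euler_density.
move: (conformal_factor x ^+ N) => CN.
by field; rewrite !gt_eqF.
Qed.

Lemma hardy_density x : punctured_ball x ->
  `|f x| ^+ 2 / hyp_rho x ^+ 2 * conformal_factor x ^+ N =
  sq_density f x * ker_rho2 (euclid_norm x).
Proof.
move=> [Ux x0]; rewrite real_normK ?num_real// hyp_rhoE// /sq_density /ker_rho2.
by ring.
Qed.

Lemma curvature_density x : punctured_ball x ->
  (hyp_rho x * cosh (hyp_rho x) - sinh (hyp_rho x)) /
    (hyp_rho x ^+ 2 * sinh (hyp_rho x)) * `|f x| ^+ 2 * conformal_factor x ^+ N =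
  sq_density f x * ker_curv 1 (euclid_norm x).
Proof.
move=> Px; have [Ux x0] := Px; have r01 := punctured_ball_norm Px.
have /andP[r0 r1] := r01; have L0 := hyp_radius_gt0 r01.
rewrite real_normK ?num_real// hyp_rhoE// cosh_hyp_radius ?euclid_norm_itv//.
rewrite sinh_hyp_radius ?euclid_norm_itv// /sq_density /ker_curv /ker_rho /ker_rho2.
move: (conformal_factor x ^+ N) => CN.
by field; rewrite !gt_eqF//; nra.
Qed.

End weighted_function.

Section assembly.
Context {R : realType} {N : nat}.
Variables (f : 'rV[R]_N -> R) (K : set 'rV[R]_N).
Hypothesis sf : smooth_on poincare_ball f.
Hypothesis cK : compact K.
Hypothesis KU : K `<=` poincare_ball.
Hypothesis fK : forall x, poincare_ball x -> ~ K x -> f x = 0.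
Hypothesis N3 : (3 <= N)%N.
Local Notation mu := (@lebesgue_tuple R N).
Local Notation ze := (zero_ext punctured_ball).

(** The part common to the gradient and the radial identity: FE is the squared
    derivative of f, FC the weighted squared derivative of rho^((N - 2) / 2) f, and
    the hypothesis on FC is the expansion of its square. The divergence term
    enters with zero integral. *)
Lemma hardy_identity (FE FC GE : 'rV[R]_N -> R) :
  (forall x, punctured_ball x -> {for x, continuous GE}) ->
  mu.-integrable setT (EFin \o ze GE) ->
  (forall x, punctured_ball x -> FE x * conformal_factor x ^+ N = GE x) ->
  (forall x, punctured_ball x -> FC x * conformal_factor x ^+ N =
    GE x + (N%:R - 2) * (mixed_density f x * ker_rho (euclid_norm x)) +
    ((N%:R - 2) / 2) ^+ 2 * (sq_density f x * ker_rho2 (euclid_norm x))) ->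
  (hyp_integral FE - (((N%:R - 2) / 2) ^+ 2)%:E *
      hyp_integral (fun x => (`|f x| ^+ 2 / hyp_rho x ^+ 2)%R) =
   hyp_integral FC + ((N%:R - 2) * (N%:R - 1) / 2)%:E *
      hyp_integral (fun x =>
        ((hyp_rho x * cosh (hyp_rho x) - sinh (hyp_rho x)) /
          (hyp_rho x ^+ 2 * sinh (hyp_rho x)) * `|f x| ^+ 2)%R))%E.
Proof.
move=> cGE iGE FGE FGC; have N0 : (0 < N)%N by exact: leq_trans N3.
set a := (N%:R - 2) / 2; set k := (N%:R - 2) * (N%:R - 1) / 2.
pose GB x := sq_density f x * ker_rho2 (euclid_norm x).
pose G0 x := sq_density f x * ker_curv 1 (euclid_norm x).
pose GC x := GE x + ((- a ^+ 2) * GB x + ((- k) * G0 x + a * flux_div f x)).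
have cGB x : punctured_ball x -> {for x, continuous GB}.
  move=> Px; apply: continuous_kernel => //; last exact: ker_rho2_continuous.
  by apply: (sq_density_continuous sf); case: Px.
have cG0 x : punctured_ball x -> {for x, continuous G0}.
  move=> Px; apply: continuous_kernel => //; last by move=> r; exact: ker_curv_continuous.
  by apply: (sq_density_continuous sf); case: Px.
have cGC x : punctured_ball x -> {for x, continuous GC}.
  move=> Px; apply: continuous_atD; first exact: cGE.
  apply: continuous_atD.
    by apply: continuous_atM; [exact: continuous_at_cst|exact: cGB].
  apply: continuous_atD.
    by apply: continuous_atM; [exact: continuous_at_cst|exact: cG0].
  by apply: continuous_atM; [exact: continuous_at_cst|exact: (flux_div_continuous sf)].
have iB : mu.-integrable setT (EFin \o ze GB).
  apply: (@integrable_kernel _ _ _ _ K 4^-1) => //.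
  - exact: (sq_density_continuous sf).
  - exact: (sq_density_off fK).
  - exact: ker_rho2_continuous.
  - move=> r r01; have /andP[h1 h2] := ker_rho2_bound r01.
    by rewrite -[X in _ * X]ger0_norm ?sqr_ge0// -normrM ger0_norm.
have i0 : mu.-integrable setT (EFin \o ze G0).
  exact: (integrable_dens00 sf cK KU fK N3 ler01).
have iD := integrable_flux_div sf cK KU fK N3.
rewrite (hyp_integralE N0 cGE FGE).
rewrite (hyp_integralE N0 cGB (@hardy_density _ _ f)).
rewrite (hyp_integralE N0 cG0 (@curvature_density _ _ f)).
rewrite (@hyp_integralE _ _ FC GC N0 cGC); last first.
  move=> x Px; rewrite FGC// /GC /GB /G0 /flux_div /ker_curv /a /k.
  by field.
have fE := integrable_fin_num measurableT iGE.
have fB := integrable_fin_num measurableT iB.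
have f0 := integrable_fin_num measurableT i0.
have -> : (\int[mu]_t (ze GC t)%:E = \int[mu]_t (ze GE t)%:E +
    ((- a ^+ 2)%:E * \int[mu]_t (ze GB t)%:E +
    ((- k)%:E * \int[mu]_t (ze G0 t)%:E + a%:E * 0)))%E.
  rewrite -[0%E in RHS](integral_flux_div sf cK KU fK N3).
  have iB' := integrableZl measurableT (- a ^+ 2) iB.
  have i0' := integrableZl measurableT (- k) i0.
  have iD' := integrableZl measurableT a iD.
  have i1 := integrableD measurableT i0' iD'.
  have i2 := integrableD measurableT iB' i1.
  rewrite -!integralZl// -!integralD//.
  apply: eq_integral => t _; rewrite -!EFinM -!EFinD; congr EFin.
  by rewrite /zero_ext; case: ifPn => // _; rewrite !mulr0 !addr0.
move: fE fB f0; rewrite -/(ze GE) => fE fB f0.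
rewrite mule0 adde0 -(fineK fE) -(fineK fB) -(fineK f0) -!EFinM -!EFinD.
by congr EFin; ring.
Qed.

End assembly.

Theorem theorem1p3 (R : realType) (N : nat) (N_ge2 : (2 <= N)%N)
    (f : 'rV[R]_N -> R) (f_test : hyp_test_function f) :
  let n : R := N%:R in
  let rho : 'rV[R]_N -> R := hyp_rho in
  let h (x : 'rV[R]_N) : R := rho x `^ ((n - 2) / 2) * f x in
  let hardy_term : \bar R :=
    ((((n - 2) / 2) ^+ 2)%:E
       * hyp_integral (fun x => (`|f x| ^+ 2 / rho x ^+ 2)%R))%E in
  let curvature_term : \bar R :=
    (((n - 2) * (n - 1) / 2)%:E
       * hyp_integral (fun x =>
           ((rho x * cosh (rho x) - sinh (rho x))
              / (rho x ^+ 2 * sinh (rho x)) * `|f x| ^+ 2)%R))%E in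
  (hyp_integral (fun x => (hyp_grad_norm f x ^+ 2)%R) - hardy_term
   = hyp_integral (fun x => (1 / rho x `^ (n - 2) * hyp_grad_norm h x ^+ 2)%R)
     + curvature_term)%E
  /\
  (hyp_integral (fun x => (`|hyp_radial f x| ^+ 2)%R) - hardy_term
   = hyp_integral (fun x => (1 / rho x `^ (n - 2) * `|hyp_radial h x| ^+ 2)%R)
     + curvature_term)%E.
Proof.
move=> n rho h hardy curv.
have [N2|N3] := leqP N 2.
  (* The coefficients vanish, which matters since the Hardy integral is infinite
     when f 0 <> 0; the weight is 1 even at the centre, where rho = 0. *)
  have n2 : n - 2 = 0.
    by rewrite /n (_ : N = 2%N) ?subrr//; apply/eqP; rewrite eqn_leq N2 N_ge2.
  have hE : h = f by apply/funext => x; rewrite /h n2 mul0r powRr0 mul1r.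
  have w1 (g : 'rV[R]_N -> R) : (fun x => 1 / rho x `^ (n - 2) * g x) = g.
    by apply/funext => x; rewrite n2 powRr0 divr1 mul1r.
  rewrite /hardy /curv hE (w1 (fun x => hyp_grad_norm f x ^+ 2)).
  rewrite (w1 (fun x => `|hyp_radial f x| ^+ 2)) n2.
  by rewrite !mul0r expr0n !mul0e oppe0 !adde0.
have [sf [K [cK KU fK]]] := f_test.
have df x : punctured_ball x -> differentiable f x.
  by case=> Ux _; exact: (test_differentiable sf).
split.
- have cG x : punctured_ball x -> {for x, continuous (grad_density f)}.
    by case=> Ux _; exact: (grad_density_continuous sf).
  apply: (hardy_identity sf cK KU fK N3 cG).
  + have : (lebesgue_tuple N).-integrable setT (EFin \o zero_ext punctured_ball
        (fun x : 'rV[R]_N => grad_density f x * cst 1 (euclid_norm x))).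
      apply: (@integrable_kernel _ _ _ _ K 1) => //.
      - exact: (grad_density_continuous sf).
      - exact: (grad_density_off cK fK).
      - by move=> r _; exact: cst_continuous.
      - by move=> r /andP[r0 r1]; rewrite normr1 mul1r; nra.
    by apply: eq_integrable => // t _ /=; rewrite /zero_ext mulr1.
  + by move=> x [Ux _]; exact: hyp_grad_norm_density.
  + by move=> x Px; exact: (weighted_gradient_density _ Px (df _ Px)).
- have inv2_continuous (r : R) : 0 < r < 1 -> {for r, continuous (fun s : R => (s ^+ 2)^-1)}.
    move=> /andP[r0 _]; apply: continuous_atV; first by rewrite expf_neq0// gt_eqF.
    by apply: continuous_atX; exact: cvg_id.
  apply: (@hardy_identity _ _ _ _ sf cK KU fK N3 _ _
    (fun x => euler_density f x * (euclid_norm x ^+ 2)^-1)).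
  + move=> x Px; apply: (continuous_kernel Px _ inv2_continuous).
    by case: Px => Ux _; exact: (euler_density_continuous sf).
  + apply: (@integrable_kernel _ _ _ (fun r : R => (r ^+ 2)^-1) K 1) => //.
    * exact: (euler_density_continuous sf).
    * exact: (euler_density_off cK fK).
    * move=> r /andP[r0 _]; rewrite ger0_norm ?invr_ge0 ?sqr_ge0//.
      by rewrite mulVf// expf_neq0// gt_eqF.
  + by move=> x Px; exact: (hyp_radial_density Px (df _ Px)).
  + by move=> x Px; exact: (weighted_radial_density _ Px (df _ Px)).
Qed.
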